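(* Let $R$ be a standard graded $k$-algebra with $e=\operatorname{rank}_kR_1$, and let $M$ be a non-zero (finitely generated graded) $R$-module. If $M_j=0$ for $j\neq 0,1$ and $M$ is Koszul, then $R$ is a Koszul algebra. If, furthermore, there is an integer $p$ such that $\beta^R_{i,i}(M)=p$ for all $i\ge 0$, then $$H_R(s)=(1+s)\cdot(1+(e-1)s)\quad\text{and}\quad H_M(s)=p\cdot(1+(e-1)s).$$
   Context: $k$ is a field. A standard graded $k$-algebra is a commutative graded algebra $R=\bigoplus_{j\ge0}R_j$ with $R_0=k$, generated over $k$ by finitely many elements of degree one. Modules are finitely generated and $\mathbb Z$-graded; $M(d)$ denotes the shift $M(d)_j=M_{j+d}$. The Hilbert series is $H_M(s)=\sum_j(\operatorname{rank}_kM_j)s^j$. The graded Betti number $\beta^R_{i,j}(M)$ is the number of copies of $R(-j)$ in the $i$th module of a minimal graded free resolution of $M$ over $R$, i.e. $\beta^R_{i,j}(M)=\operatorname{rank}_k\operatorname{Tor}^R_i(M,k)_j$. A graded module $M$ is linear if for some $d\in\mathbb Z$ one has $\beta^R_{i,j}(M)=0$ whenever $j-i\neq d$; for $M\ne0$ then $d=\inf M:=\inf\{j: M_j\neq0\}$. A Koszul module is a linear module with $\inf M=0$. The algebra $R$ is Koszul if $k=R/\bigoplus_{j\ge1}R_j$ is a linear $R$-module. *)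

(* Defs.v *)
From HB Require Import structures.
From mathcomp Require Import all_boot all_order all_algebra.
From mathcomp Require Import boolp classical_sets.

Set Implicit Arguments.
Unset Strict Implicit.
Unset Printing Implicit Defensive.

Import Order.TTheory GRing.Theory Num.Theory.
Local Open Scope ring_scope.
Local Open Scope classical_set_scope.

Definition direct_sum (I : eqType) (V : zmodType) (V_ : I -> set V) : Prop :=
  [/\ forall i, V_ i 0 /\ (forall x y, V_ i x -> V_ i y -> V_ i (x - y)),
      forall v, exists (s : seq I) (f : I -> V),
        (forall i, V_ i (f i)) /\ v = \sum_(i <- s) f i
    & forall (s : seq I) (f : I -> V), uniq s -> (forall i, V_ i (f i)) ->
        \sum_(i <- s) f i = 0 -> {in s, forall i, f i = 0}].

(* A commutative k-algebra graded by gR, with R_0 = k and finitely many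
   k-algebra generators, all of degree one.  The third clause also makes every
   gR j a k-subspace. *)
Definition standard_graded (k : fieldType) (R : comAlgType k)
    (gR : nat -> set R) : Prop :=
  [/\ direct_sum gR,
      forall i j x y, gR i x -> gR j y -> gR (i + j)%N (x * y),
      gR 0%N = range (fun c : k => c%:A)
    & exists (n : nat) (x : 'I_n -> R),
        (forall i, gR 1%N (x i)) /\
        (forall S : {pred R}, subalg_closed S -> (forall i, x i \in S) ->
           forall r, r \in S)].

Definition graded_module (k : fieldType) (R : comAlgType k)
    (gR : nat -> set R) (M : lmodType R) (gM : int -> set M) : Prop :=
  direct_sum gM /\
  forall (i : nat) (j : int) r m, gR i r -> gM j m -> gM (i%:Z + j) (r *: m).

Definition fin_generated (R : comNzRingType) (M : lmodType R) : Prop :=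
  exists (n : nat) (g : 'I_n -> M),
    forall m, exists c : 'I_n -> R, m = \sum_i c i *: g i.

(* The grading of R extended by R_j = 0 for j < 0. *)
Definition zgrading (R : comNzRingType) (gR : nat -> set R) (j : int) : set R :=
  if j is Posz n then gR n else [set 0].

(* The ideal \bigoplus_(j >= 1) R_j. *)
Definition irrelevant (R : comNzRingType) (gR : nat -> set R) : set R :=
  [set r | exists (n : nat) (f : nat -> R),
     (forall i, gR i (f i)) /\ r = \sum_(1 <= i < n) f i].

(* A minimal graded free resolution of M by free modules of finite rank,
   written in homogeneous bases.  The i-th module is
   F_i = \bigoplus_(a < res_rank i) R(- res_deg a), whose elements are row
   vectors; row a of res_diff i is the image in F_i of the a-th basis element
   of F_(i+1), and res_aug a is the image in M of the a-th basis element of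
   F_0.  Minimality says that the image of F_(i+1) lies in R_+ F_i. *)
Record min_free_resolution (k : fieldType) (R : comAlgType k)
    (gR : nat -> set R) (M : lmodType R) (gM : int -> set M) := MinFreeRes {
  res_rank : nat -> nat;
  res_deg : forall i, 'I_(res_rank i) -> int;
  res_diff : forall i, 'M[R]_(res_rank i.+1, res_rank i);
  res_aug : 'I_(res_rank 0) -> M;
  res_diff_homog : forall i a b,
    zgrading gR (res_deg a - res_deg b) (res_diff i a b);
  res_aug_homog : forall a, gM (res_deg a) (res_aug a);
  res_aug_surj : forall m : M, exists v : 'rV[R]_(res_rank 0),
    m = \sum_a v 0 a *: res_aug a;
  res_exact0 : forall v : 'rV[R]_(res_rank 0),
    \sum_a v 0 a *: res_aug a = 0 <-> exists w, v = w *m res_diff 0;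
  res_exactS : forall i (v : 'rV[R]_(res_rank i.+1)),
    v *m res_diff i = 0 <-> exists w, v = w *m res_diff i.+1;
  res_minimal : forall i a b, irrelevant gR (res_diff i a b)
}.

(* graded_betti gR gM b reads: beta^R_(i,j)(M) = b i j for all i and j.
   It is a relation because a minimal resolution is unique only up to
   isomorphism. *)
Definition graded_betti (k : fieldType) (R : comAlgType k)
    (gR : nat -> set R) (M : lmodType R) (gM : int -> set M)
    (b : nat -> int -> nat) : Prop :=
  exists F : min_free_resolution gR gM,
    forall i j, b i j = #|[set a : 'I_(res_rank F i) | res_deg a == j]%SET|.

Definition linear_module (k : fieldType) (R : comAlgType k)
    (gR : nat -> set R) (M : lmodType R) (gM : int -> set M) : Prop :=
  exists2 b, graded_betti gR gM b &
    exists d : int, forall (i : nat) (j : int), j - i%:Z <> d -> b i j = 0%N.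

(* inf {j | M_j <> 0} = d; a finite infimum of integers is attained. *)
Definition inf_degree (V : zmodType) (gM : int -> set V) (d : int) : Prop :=
  (exists2 m, gM d m & m <> 0) /\
  forall j m, j < d -> gM j m -> m = 0.

Definition koszul_module (k : fieldType) (R : comAlgType k)
    (gR : nat -> set R) (M : lmodType R) (gM : int -> set M) : Prop :=
  linear_module gR gM /\ inf_degree gM 0.

Section Augmentation.
Context (k : fieldType) (R : comAlgType k) (gR : nat -> set R)
  (hR : standard_graded gR).

Definition augmentation (r : R) : k :=
  xget 0 [set c : k | irrelevant gR (r - c%:A)].

Lemma graded0 i : gR i 0.
Proof. by case: hR => [[h _ _] _ _ _]; case: (h i). Qed.

#[local] Hint Resolve graded0 : core.

Lemma gradedB i x y : gR i x -> gR i y -> gR i (x - y).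
Proof. by case: hR => [[h _ _] _ _ _]; case: (h i) => _; apply. Qed.

Lemma gradedN i x : gR i x -> gR i (- x).
Proof. by move=> hx; rewrite -sub0r; apply: gradedB. Qed.

Lemma gradedD i x y : gR i x -> gR i y -> gR i (x + y).
Proof. by move=> hx /gradedN hy; rewrite -[y]opprK; apply: gradedB. Qed.

Lemma irrelevant0 : irrelevant gR 0.
Proof. by exists 0%N, (fun=> 0); split=> //; rewrite big1. Qed.

#[local] Hint Resolve irrelevant0 : core.

Lemma irrelevantN x : irrelevant gR x -> irrelevant gR (- x).
Proof.
move=> [n [f [hf ->]]]; exists n, (fun i => - f i).
by split; [move=> i; apply: gradedN | rewrite sumrN].
Qed.

Lemma irrelevant_pad n N f : (n <= N)%N ->
  \sum_(1 <= i < n) f i = \sum_(1 <= i < N) (if (i < n)%N then f i else 0) :> R.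
Proof.
move=> nN; case: (leqP 1 n) => [n1|]; last first.
  rewrite ltnS leqn0 => /eqP ->.
  by rewrite big_geq // big1 // => i _; rewrite ltn0.
rewrite (big_cat_nat n1 nN) /= [X in _ = _ + X]big_nat_cond.
rewrite [X in _ = _ + X]big1 ?addr0.
  by apply: eq_big_nat => i /andP[_ ->].
by move=> i; rewrite andbT => /andP[]; rewrite leqNgt => /negbTE->.
Qed.

Lemma irrelevantD x y :
  irrelevant gR x -> irrelevant gR y -> irrelevant gR (x + y).
Proof.
move=> [n [f [hf ->]]] [m [g [hg ->]]].
exists (maxn n m), (fun i => (if (i < n)%N then f i else 0) +
                             (if (i < m)%N then g i else 0)); split.
  by move=> i; apply: gradedD; case: ifP.
rewrite (irrelevant_pad f (leq_maxl n m)) (irrelevant_pad g (leq_maxr n m)).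
by rewrite -big_split.
Qed.

Lemma irrelevant_homog i x : (0 < i)%N -> gR i x -> irrelevant gR x.
Proof.
move=> i0 hx; exists i.+1, (fun j => if j == i then x else 0); split.
  by move=> j; case: eqP => [->|].
rewrite big_nat_recr //= eqxx big_nat_cond big1 ?add0r // => j.
by rewrite andbT => /andP[_]; rewrite ltn_neqAle => /andP[/negbTE->].
Qed.

Lemma irrelevantM_homog i x y :
  gR i x -> irrelevant gR y -> irrelevant gR (x * y).
Proof.
move=> hx [n [g [hg ->]]]; rewrite mulr_sumr big_nat_cond.
apply: (big_ind _ irrelevant0 irrelevantD) => j; rewrite andbT => /andP[j1 _].
apply: (@irrelevant_homog (i + j)); first by rewrite addn_gt0 j1 orbT.
by case: hR => [_ h _ _]; apply: h.
Qed.

Lemma irrelevantM x y : irrelevant gR y -> irrelevant gR (x * y).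
Proof.
move=> hy; case: hR => [[_ h _] _ _ _]; have [s [f [hf ->]]] := h x.
rewrite mulr_suml; apply: (big_ind _ irrelevant0 irrelevantD) => i _.
exact: irrelevantM_homog (hf i) hy.
Qed.

Lemma irrelevant_scalar c : irrelevant gR c%:A -> c = 0.
Proof.
move=> [n [f [hf e]]]; case: hR => [[_ _ h] _ hk _].
have eg : \sum_(0 <= i < n.+1) (if (0 < i < n)%N then f i else 0) =
          \sum_(1 <= i < n) f i.
  rewrite big_nat_recl //= add0r.
  case: n {e} => [|n]; first by rewrite !big_geq.
  rewrite big_add1 /= big_nat_recr //= ltnn addr0.
  by apply: eq_big_nat => i /andP[_ hi]; rewrite ltnS hi.
pose g i := if i == 0%N then c%:A else if (0 < i < n)%N then - f i else 0.
have := h (index_iota 0 n.+1) g (iota_uniq _ _).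
have hg i : gR i (g i).
  rewrite /g; case: eqP => [->|_]; first by rewrite hk; exists c.
  by case: ifP => _ //; apply: gradedN.
move=> /(_ hg) /= hh.
have /hh : \sum_(i <- index_iota 0 n.+1) g i = 0.
  rewrite big_nat_recl //= /g /= e -eg big_nat_recl //= add0r.
  by rewrite -big_split big1 //= => i _; case: ifP => _; rewrite ?subrr ?addr0.
move=> /(_ 0%N); rewrite mem_index_iota /= /g /= => /(_ isT) c0.
apply/eqP/negP => /negP cn0; move/eqP: (oner_neq0 R); apply.
by rewrite -[1]scale1r -(mulVf cn0) -scalerA c0 scaler0.
Qed.

Lemma augmentationP r : irrelevant gR (r - (augmentation r)%:A).
Proof.
rewrite /augmentation.
suff [c hc] : exists c : k, irrelevant gR (r - c%:A).
  by case: xgetP => [d _ //|/(_ c)].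
case: hR => [[_ h _] _ hk _]; have [s [f [hf ->]]] := h r.
elim: s => [|i s [c hc]]; first by exists 0; rewrite big_nil scale0r subr0.
rewrite big_cons; case: (posnP i) => [->|i0].
  have := hf 0%N; rewrite hk => -[d _ <-]; exists (d + c).
  by rewrite scalerDl opprD addrACA subrr add0r.
by exists c; rewrite -addrA; apply: irrelevantD hc;
  apply: irrelevant_homog (hf i).
Qed.

#[local] Hint Resolve augmentationP : core.

Lemma augmentationE r c : irrelevant gR (r - c%:A) -> augmentation r = c.
Proof.
move=> hc; apply/eqP; rewrite -subr_eq0; apply/eqP/irrelevant_scalar.
have -> : (augmentation r - c)%:A =
    (r - c%:A) - (r - (augmentation r)%:A) :> R.
  by rewrite scalerBl opprB [RHS]addrC addrA subrK.
by apply: irrelevantD hc _; apply: irrelevantN.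
Qed.

Lemma augmentation1 : augmentation 1 = 1.
Proof. by apply: augmentationE; rewrite scale1r subrr. Qed.

Lemma augmentationD r s :
  augmentation (r + s) = augmentation r + augmentation s.
Proof.
by apply: augmentationE; rewrite scalerDl opprD addrACA; apply: irrelevantD.
Qed.

Lemma augmentationM r s :
  augmentation (r * s) = augmentation r * augmentation s.
Proof.
apply: augmentationE; set a := augmentation r; set b := augmentation s.
have -> : r * s - (a * b)%:A = r * (s - b%:A) + b%:A * (r - a%:A).
  rewrite !mulrBr [b%:A * r]mulrC addrA subrK.
  by rewrite -scalerAl mul1r scalerA [b * a]mulrC.
by apply: irrelevantD; apply: irrelevantM.
Qed.

(* k as an R-module, R acting through R -> R / R_+ = k. *)
Definition residue_field of standard_graded gR : Type := k.
HB.instance Definition _ := GRing.Zmodule.on (residue_field hR).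

Definition residue_scale (r : R) (c : residue_field hR) : residue_field hR :=
  augmentation r * (c : k).

Fact residue_scaleA r s c :
  residue_scale r (residue_scale s c) = residue_scale (r * s) c.
Proof. by rewrite /residue_scale augmentationM mulrA. Qed.

Fact residue_scale1 : left_id 1 residue_scale.
Proof. by move=> c; rewrite /residue_scale augmentation1 mul1r. Qed.

Fact residue_scaleDr : right_distributive residue_scale +%R.
Proof. by move=> r c d; rewrite /residue_scale -mulrDr. Qed.

Fact residue_scaleDl c :
  {morph residue_scale^~ c : r s / r + s >-> r + s}.
Proof. by move=> r s; rewrite /residue_scale augmentationD mulrDl. Qed.

HB.instance Definition _ := GRing.Zmodule_isLmodule.Build R (residue_field hR)
  residue_scaleA residue_scale1 residue_scaleDr residue_scaleDl.

Definition residue_grading (j : int) : set (residue_field hR) :=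
  if j == 0 then setT else [set 0].

Definition koszul_algebra : Prop := linear_module gR residue_grading.

End Augmentation.

(* k acts on the R-module M through the structure map c |-> c%:A. *)
Definition is_krank (k : fieldType) (R : comAlgType k) (M : lmodType R)
    (U : set M) (n : nat) : Prop :=
  exists u : 'I_n -> M,
    [/\ forall i, U (u i),
        forall v, U v -> exists c : 'I_n -> k, v = \sum_i (c i)%:A *: u i
      & forall c : 'I_n -> k,
          \sum_i (c i)%:A *: u i = 0 -> forall i, c i = 0].

(* The value is 0 on subspaces of infinite rank, which do not occur as
   components of finitely generated modules. *)
Definition krank (k : fieldType) (R : comAlgType k) (M : lmodType R)
    (U : set M) : nat :=
  xget 0%N [set n | is_krank U n].

(* Formal series \sum_j a_j s^j with j ranging over int are represented by
   their coefficient functions. *)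
Definition hilbert_series (k : fieldType) (R : comAlgType k) (M : lmodType R)
    (gM : int -> set M) : int -> int :=
  fun j => (krank (gM j))%:Z.

Definition series_of_poly (P : {poly int}) : int -> int :=
  fun j => if j is Posz n then P`_n else 0.

(* Main.v *)
Require Import Defs.
From HB Require Import structures.
From mathcomp Require Import all_boot all_order all_algebra.
From mathcomp Require Import boolp classical_sets.

Set Implicit Arguments.
Unset Strict Implicit.
Unset Printing Implicit Defensive.

Import Order.TTheory GRing.Theory Num.Theory.
Local Open Scope ring_scope.
Local Open Scope classical_set_scope.

(** Let R_+ be the ideal of elements of positive degree of R.

    Koszulness.  For a module M living in degrees 0 and 1 and generated by a
    basis g of M_0, with b = rank M_0, sending a row v to its combination of
    the g_a gives an exact sequence
      0 -> Syz(g) -> (R_+)^b -> M_1 -> 0,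
    because a combination with coefficients in R_+ has degree at least 1.  The
    term Syz(g) has a linear resolution since M does, and M_1 is a sum of
    copies of k(-1).  Now (R_+)^q is the first syzygy of k^q, so if all the
    (R_+)^q are linear up to step n, then M_1 is linear up to step n + 1.
    Linearity passes to extensions (linear_to_ext), so (R_+)^b is linear up to
    step n + 1, hence so is its direct summand R_+ (linear_to_retract), and hence
    so are all the (R_+)^q.  By induction, R_+ is linear up to every step
    (linear_to_irr_rows_of_module), and k has a linear resolution.

    The whole argument is carried out with kernels of explicit generating
    families instead of Tor: linear_to n says that n + 1 steps of the
    resolution exist and are linear, for some choice of bases.  That the
    choice does not matter is linear_to_basis.  Since generation in the right
    degree is part of what is propagated, every kernel met is generated by one
    component of finite rank, and this is what makes the free modules in the
    resolution of k have finite rank (koszul_of_linear).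

    Hilbert series.  A minimal resolution of M with arbitrary degrees is first
    shown to be linear, one free module after the other (resolution_linear).  Its ranks are then all equal to p, and counting ranks
    degree by degree along it, the i-th syzygies have the same Hilbert
    function mu as M, whatever i (hilbert_recursion), so that
      mu_j + mu_(j+1) = p rank R_(j+1).
    As mu_0 = p and mu_j = 0 for j > 1, this gives rank R_2 = e - 1,
    rank R_j = 0 for j > 2 and mu_1 = p (e - 1). *)

(** * Linear combinations with row coefficients *)

Section Combinations.
Context (R : comNzRingType) (V : lmodType R).

Definition comb b (g : 'I_b -> V) (v : 'rV[R]_b) : V := \sum_a v 0 a *: g a.

Fact comb_is_linear b (g : 'I_b -> V) : linear (comb g).
Proof.
move=> r u v; rewrite /comb scaler_sumr -big_split /=.
by apply: eq_bigr => a _; rewrite !mxE scalerDl scalerA.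
Qed.

HB.instance Definition _ b (g : 'I_b -> V) :=
  GRing.isLinear.Build R 'rV[R]_b V _ (comb g) (comb_is_linear g).

Lemma comb_delta b (g : 'I_b -> V) a : comb g (delta_mx 0 a) = g a.
Proof.
rewrite /comb (bigD1 a) //= mxE !eqxx scale1r big1 ?addr0 // => i /negbTE ia.
by rewrite mxE eqxx ia scale0r.
Qed.

Lemma comb_mulmx b c (h : 'I_c -> V) (v : 'rV[R]_b) (P : 'M[R]_(b, c)) :
  comb h (v *m P) = comb (fun a => comb h (row a P)) v.
Proof.
by rewrite mulmx_sum_row linear_sum; apply: eq_bigr => a _; rewrite linearZ.
Qed.

Lemma eq_comb b (g h : 'I_b -> V) (v : 'rV[R]_b) :
  g =1 h -> comb g v = comb h v.
Proof. by move=> gh; apply: eq_bigr => a _; rewrite gh. Qed.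

Definition glue b c (g : 'I_b -> V) (h : 'I_c -> V) (a : 'I_(b + c)) : V :=
  match split a with inl i => g i | inr i => h i end.

Lemma comb_glue b c (g : 'I_b -> V) (h : 'I_c -> V) v w :
  comb (glue g h) (row_mx v w) = comb g v + comb h w.
Proof.
rewrite /comb /glue big_split_ord; congr (_ + _); apply: eq_bigr => i _.
  by rewrite row_mxEl (unsplitK (inl i)).
by rewrite row_mxEr (unsplitK (inr i)).
Qed.

End Combinations.

Lemma raddf_comb (R : comNzRingType) (V W : lmodType R) (f : {linear V -> W})
  b (g : 'I_b -> V) v : f (comb g v) = comb (f \o g) v.
Proof. by rewrite linear_sum; apply: eq_bigr => a _; rewrite linearZ. Qed.

Lemma comb_rows (R : comNzRingType) b c (P : 'M[R]_(b, c)) v :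
  comb (fun a => row a P) v = v *m P.
Proof. by rewrite mulmx_sum_row. Qed.

(** * Bases and ranks over k *)

Section ScalarRank.
Context (k : fieldType) (R : comAlgType k).
Local Notation "A ^K" := (map_mx (in_alg R) A) (at level 8, format "A ^K").

Definition kbasis (V : lmodType R) (U : set V) b (g : 'I_b -> V) : Prop :=
  [/\ forall a, U (g a), forall x, U x -> exists c : 'rV[k]_b, x = comb g c^K
    & forall c : 'rV[k]_b, comb g c^K = 0 -> c = 0].

Lemma kbasis_krank (V : lmodType R) (U : set V) b (g : 'I_b -> V) :
  kbasis U g -> is_krank U b.
Proof.
move=> [Ug gen ind]; exists g; split=> // [x /gen [c ->]|c c0 i].
  by exists (c 0); apply: eq_bigr => i _; rewrite mxE.
have /rowP/(_ i) : \row_i c i = 0.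
  by apply: ind; rewrite -[RHS]c0; apply: eq_bigr => j _; rewrite !mxE.
by rewrite !mxE.
Qed.

Lemma krank_kbasis (V : lmodType R) (U : set V) b :
  is_krank U b -> exists g : 'I_b -> V, kbasis U g.
Proof.
move=> [g [Ug gen ind]]; exists g; split=> // [x /gen [c ->]|c c0].
  by exists (\row_i c i); apply: eq_bigr => i _; rewrite !mxE.
apply/rowP => i; rewrite [RHS]mxE; apply: (ind (c 0)).
by rewrite -[RHS]c0; apply: eq_bigr => j _; rewrite mxE.
Qed.

Lemma basis_change (V : lmodType R) (U : set V) b c (g : 'I_b -> V)
  (h : 'I_c -> V) : (forall a, U (g a)) ->
  (forall x, U x -> exists c : 'rV[k]_c, x = comb h c^K) ->
  exists P : 'M[k]_(b, c), forall v, comb g v = comb h (v *m P^K).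
Proof.
move=> Ug gen; have /choice [P hP] a := gen _ (Ug a).
exists (\matrix_(i, j) P i 0 j) => v; rewrite comb_mulmx; apply: eq_comb => a.
by rewrite hP; congr comb; apply/rowP => j; rewrite !mxE.
Qed.

(** Expressing g in terms of h and back gives for each row of P *m Q - 1 a
    relation between the g_a. *)
Lemma indep_change (V : lmodType R) b c (g : 'I_b -> V) (h : 'I_c -> V)
  (P : 'M[k]_(b, c)) (Q : 'M[k]_(c, b)) :
  (forall v, comb g v = comb h (v *m P^K)) ->
  (forall v, comb h v = comb g (v *m Q^K)) ->
  (forall c : 'rV[k]_b, comb g c^K = 0 -> c = 0) -> P *m Q = 1%:M.
Proof.
move=> hP hQ ind; apply/eqP; rewrite -subr_eq0; apply/eqP/row_matrixP => i.
rewrite row0; apply: ind; rewrite linearB /= row1 map_mxB linearB /=.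
rewrite rowE !map_mxM mulmxA -hQ -hP !map_delta_mx /=.
by rewrite subrr.
Qed.

Lemma kbasis_size (V : lmodType R) (U : set V) b c (g : 'I_b -> V)
  (h : 'I_c -> V) : kbasis U g -> kbasis U h -> b = c.
Proof.
move=> [Ug geng indg] [Uh genh indh].
have [P hP] := basis_change Ug genh; have [Q hQ] := basis_change Uh geng.
apply/eqP; rewrite eqn_leq.
rewrite (mulmx1_min (indep_change hP hQ indg)).
by rewrite (mulmx1_min (indep_change hQ hP indh)).
Qed.

Lemma krankE (V : lmodType R) (U : set V) n : is_krank U n -> krank U = n.
Proof.
move=> Un; rewrite /krank; case: xgetP => [m _ /= Um|/(_ n) //].
have [g hg] := krank_kbasis Um; have [h hh] := krank_kbasis Un.
exact: kbasis_size hg hh.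
Qed.

(** A subspace of k^a is the row space of a matrix: among the matrices whose
    rows satisfy the relation, one of maximal rank spans everything, since a
    relation outside of its row space could be adjoined to it. *)
Lemma relation_mx (V : lmodType R) a (u : 'I_a -> V) :
  exists X : 'M[k]_a, forall c : 'rV[k]_a, comb u c^K = 0 <-> (c <= X)%MS.
Proof.
pose rel (X : 'M[k]_a) := forall c : 'rV[k]_a, (c <= X)%MS -> comb u c^K = 0.
have ex0 : exists i, `[< exists2 X, rel X & \rank X = i >].
  exists 0%N; apply/asboolP; exists 0; last exact: mxrank0.
  by move=> c; rewrite submx0 => /eqP->; rewrite map_mx0 linear0.
have ub i : `[< exists2 X, rel X & \rank X = i >] -> (i <= a)%N.
  by move=> /asboolP [X _ <-]; apply: rank_leq_row.
case: (ex_maxnP ex0 ub) => i /asboolP [X relX rX] maxX.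
exists X => c; split=> [c0|/relX //]; apply: contraT => ncX.
have : (\rank (X + c)%MS <= i)%N.
  apply: maxX; apply/asboolP; exists (X + c)%MS => //.
  (* Row spaces of sums are reached by a part in X and a multiple of c. *)
  move=> d /sub_addsmxP [[d1 d2] /= ->].
  have [z ->] : exists z, d2 = z%:M by exists (d2 0 0); apply: mx11_scalar.
  rewrite map_mxD linearD /= relX ?submxMl // mul_scalar_mx map_mxZ linearZ /=.
  by rewrite c0 scaler0 addr0.
rewrite leqNgt => /negP []; rewrite -rX.
apply: rank_ltmx; rewrite ltmxE addsmxSl.
by apply: contra ncX; apply: submx_trans (addsmxSr _ _).
Qed.

(** The coordinates of the kernel form the row space of the relation matrix X
    of the images f (u_i), and those of a complement of X map isomorphically
    onto the image of f.  The basis of the image is given with its lifts w to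
    U, which is what choosing bases along an exact sequence requires. *)
Lemma rank_nullity (V W : lmodType R) (f : {linear V -> W}) (U : set V) a
  (u : 'I_a -> V) : (forall c : 'rV[k]_a, U (comb u c^K)) -> kbasis U u ->
  exists n m (z : 'I_n -> V) (w : 'I_m -> V),
    [/\ (n + m)%N = a, kbasis [set x | U x /\ f x = 0] z,
        forall i, U (w i) & kbasis (f @` U) (f \o w)].
Proof.
move=> Uc [Uu gen ind]; have [X hX] := relation_mx (f \o u).
pose sub m (B : 'M[k]_(m, a)) i := comb u (row i B)^K.
have subE m (B : 'M[k]_(m, a)) (c : 'rV[k]_m) :
    comb (sub m B) c^K = comb u (c *m B)^K.
  rewrite map_mxM comb_mulmx; apply: eq_comb => i.
  by rewrite /sub map_row.
exists (\rank X), (\rank X^C)%MS.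
exists (sub _ (row_base X)), (sub _ (row_base X^C)%MS); split.
- by rewrite mxrank_compl subnKC // rank_leq_col.
- split=> [i|x [/gen [c ->]]|c].
  + split; first exact: Uc.
    rewrite raddf_comb; apply/hX.
    by rewrite (submx_trans (row_sub _ _)) // eq_row_base.
  + rewrite raddf_comb => /hX; rewrite -(eq_row_base X) => /submxP [d ->].
    by exists d; rewrite subE.
  + rewrite subE => /ind /eqP.
    by rewrite mulmx_free_eq0 ?row_base_free // => /eqP.
- by move=> i; apply: Uc.
split=> [i|y [x /gen [c ->] <-]|c].
- by exists (sub _ (row_base X^C)%MS i) => //; apply: Uc.
- have : (c <= X + X^C)%MS by apply: submx_full; apply: addsmx_compl_full.
  case/sub_addsmxP => -[c1 c2] /= ->.
  have : (c2 *m X^C <= row_base X^C)%MS by rewrite eq_row_base submxMl.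
  case/submxP => d ->; exists d; rewrite -raddf_comb subE map_mxD !linearD /=.
  rewrite [f (comb u _)]raddf_comb [X in X + _](_ : _ = 0) ?add0r //.
  by apply/hX; apply: submxMl.
- rewrite -raddf_comb subE raddf_comb => /hX cX; apply/eqP.
  rewrite -(mulmx_free_eq0 _ (row_base_free X^C%MS)) -submx0 -(capmx_compl X).
  by rewrite sub_capmx cX /= -(eq_row_base X^C%MS) submxMl.
Qed.

End ScalarRank.

(** * Inclusions and projections of free modules *)

Section Blocks.
Context (R : comNzRingType) (b c : nat).

Lemma mul_inl (v : 'rV[R]_b) :
  v *m row_mx 1%:M 0 = row_mx v 0 :> 'rV[R]_(b + c).
Proof. by rewrite mul_mx_row mulmx1 mulmx0. Qed.

Lemma mul_projl (v : 'rV[R]_(b + c)) : v *m col_mx 1%:M 0 = lsubmx v.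
Proof. by rewrite -{1}[v]hsubmxK mul_row_col mulmx0 mulmx1 addr0. Qed.

Lemma mul_projr (v : 'rV[R]_(b + c)) : v *m col_mx 0 1%:M = rsubmx v.
Proof. by rewrite -{1}[v]hsubmxK mul_row_col mulmx0 mulmx1 add0r. Qed.

End Blocks.

(** * Graded submodules and their syzygies *)

Section Graded.
Context (k : fieldType) (R : comAlgType k) (gR : nat -> set R)
  (hR : standard_graded gR).
Local Notation "A ^K" := (map_mx (in_alg R) A) (at level 8, format "A ^K").

Lemma graded_sum j (I : Type) (s : seq I) (P : pred I) (F : I -> R) :
  (forall i, P i -> gR j (F i)) -> gR j (\sum_(i <- s | P i) F i).
Proof.
by move=> hF; apply: big_ind => //; [apply: graded0 | apply: gradedD].
Qed.

Lemma gradedM i j x y : gR i x -> gR j y -> gR (i + j)%N (x * y).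
Proof. by case: hR => _ h _ _; apply: h. Qed.

Lemma graded_alg c : gR 0 (c%:A).
Proof. by case: hR => _ _ -> _; exists c. Qed.

Lemma graded_scalar x : gR 0 x -> exists c, x = c%:A.
Proof. by case: hR => _ _ -> _ [c _ <-]; exists c. Qed.

Definition homog b (j : nat) (v : 'rV[R]_b) : Prop := forall a, gR j (v 0 a).

Lemma homog_alg b (c : 'rV[k]_b) : homog 0 c^K.
Proof. by move=> a; rewrite mxE; apply: graded_alg. Qed.

Lemma homog_scalar b (v : 'rV[R]_b) : homog 0 v -> exists c, v = c^K.
Proof.
move=> hv; have [c hc] := choice (fun a => graded_scalar (hv a)).
by exists (\row_a c a); apply/rowP => a; rewrite !mxE.
Qed.

Lemma homog_mul_alg b c j (v : 'rV[R]_b) (P : 'M[k]_(b, c)) :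
  homog j v -> homog j (v *m P^K).
Proof.
move=> hv a; rewrite mxE; apply: graded_sum => i _.
by rewrite -[j]addn0 mxE; apply: gradedM => //; apply: graded_alg.
Qed.

Lemma homog_row_mx b c j (v : 'rV[R]_b) (w : 'rV[R]_c) :
  homog j v -> homog j w -> homog j (row_mx v w).
Proof. by move=> hv hw a; rewrite mxE; case: splitP. Qed.

Lemma homog_lsub b c j (v : 'rV[R]_(b + c)) : homog j v -> homog j (lsubmx v).
Proof. by move=> hv a; rewrite mxE. Qed.

Lemma homog_rsub b c j (v : 'rV[R]_(b + c)) : homog j v -> homog j (rsubmx v).
Proof. by move=> hv a; rewrite mxE. Qed.

Lemma homog0 b j : homog j (0 : 'rV[R]_b).
Proof. by move=> a; rewrite mxE; apply: graded0. Qed.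

(** A family of homogeneous components inside an ambient module V.  It
    represents the submodule that is their sum, which never has to be formed:
    generation, syzygies and exactness are all stated degree by degree. *)
Definition graded_sub (V : lmodType R) (N : nat -> set V) : Prop :=
  forall j, [/\ N j 0, forall x y, N j x -> N j y -> N j (x - y)
    & forall i r x, gR i r -> N j x -> N (i + j)%N (r *: x)].

Section GradedSub.
Context (V : lmodType R) (N : nat -> set V) (hN : graded_sub N).

Lemma graded_subD j x y : N j x -> N j y -> N j (x + y).
Proof.
case: (hN j) => h0 hB _ hx hy; rewrite -[y]opprK -[- y]add0r.
exact: hB hx (hB _ _ h0 hy).
Qed.

Lemma graded_sub_comb i j b (g : 'I_b -> V) (v : 'rV[R]_b) :
  homog i v -> (forall a, N j (g a)) -> N (i + j)%N (comb g v).
Proof.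
move=> hv hg; apply: big_ind => [|x y|a _]; first by case: (hN (i + j)%N).
  exact: graded_subD.
by case: (hN j) => _ _; apply.
Qed.

Lemma graded_sub_comb0 i b (g : 'I_b -> V) (v : 'rV[R]_b) :
  homog i v -> (forall a, N 0 (g a)) -> N i (comb g v).
Proof. by rewrite -{2}[i]addn0; apply: graded_sub_comb. Qed.

End GradedSub.

(** Minimal generators of a module generated in degree 0; minimality is the
    independence over k. *)
Definition generators (V : lmodType R) (N : nat -> set V) b (g : 'I_b -> V) :=
  [/\ forall a, N 0 (g a), forall c : 'rV[k]_b, comb g c^K = 0 -> c = 0
    & forall j x, N j x -> exists2 v, homog j v & comb g v = x].

Lemma generators_kbasis (V : lmodType R) (N : nat -> set V) b (g : 'I_b -> V) :
  generators N g -> kbasis (N 0) g.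
Proof.
move=> [Ng ind gen]; split=> // x /gen [v /homog_scalar [c ->] <-].
by exists c.
Qed.

(** The first syzygy module, shifted so as to start in degree 0: its component
    j consists of the relations whose coefficients have degree j + 1. *)
Definition syz (V : lmodType R) b (g : 'I_b -> V) (j : nat) : set 'rV[R]_b :=
  [set v | homog j.+1 v /\ comb g v = 0].

Lemma graded_syz (V : lmodType R) b (g : 'I_b -> V) : graded_sub (syz g).
Proof.
move=> j; split=> [|v w [hv gv] [hw gw]|i r v hr [hv gv]].
- by split; [apply: homog0 | rewrite linear0].
- split; last by rewrite linearB /= gv gw subrr.
  by move=> a; rewrite !mxE; apply: gradedB.
- split; last by rewrite linearZ /= gv scaler0.
  by move=> a; rewrite mxE -addnS; apply: gradedM.
Qed.

(** The resolution of N starts with n + 1 linear steps: N is generated in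
    degree 0 by finitely many elements, its syzygies by linear ones, and so on
    n times. *)
Fixpoint linear_to (n : nat) (V : lmodType R) (N : nat -> set V) : Prop :=
  exists b (g : 'I_b -> V),
    generators N g /\ if n is n'.+1 then linear_to n' (syz g) else True.

(** Exactness of 0 -> N1 -> N2 -> N3 -> 0, where N1 and N2 are submodules of
    the same ambient module.  Taking N1 = 0 expresses that f is an isomorphism
    of N2 onto N3. *)
Definition short_exact (V W : lmodType R) (f : V -> W)
  (N1 N2 : nat -> set V) (N3 : nat -> set W) : Prop :=
  forall j, [/\ forall x, N1 j x <-> N2 j x /\ f x = 0,
    forall x, N2 j x -> N3 j (f x)
    & forall y, N3 j y -> exists2 x, N2 j x & f x = y].

Section Isomorphism.
Context (V W : lmodType R) (f : {linear V -> W}).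
Context (N : nat -> set V) (N' : nat -> set W).
Hypotheses (hN : graded_sub N) (hf : short_exact f (fun=> [set 0]) N N').

Lemma iso_inj j x : N j x -> f x = 0 -> x = 0.
Proof. by case: (hf j) => h _ _ hx fx; apply/h. Qed.

Lemma generators_iso b (g : 'I_b -> V) :
  generators N g -> generators N' (f \o g).
Proof.
move=> [Ng ind gen]; split=> [a|c|j y].
- by case: (hf 0) => _ + _; apply.
- rewrite -raddf_comb => c0; apply: ind; apply: iso_inj c0.
  by apply: (graded_sub_comb0 hN) Ng; apply: homog_alg.
- case: (hf j) => _ _ h /h [x /gen [v hv <-] <-].
  by exists v => //; rewrite raddf_comb.
Qed.

Lemma syz_iso b (g : 'I_b -> V) : (forall a, N 0 (g a)) -> syz (f \o g) = syz g.
Proof.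
move=> Ng; apply/funext => j; apply/predeqP => v; split=> -[hv].
  rewrite -raddf_comb => /iso_inj v0; split=> //; apply: v0.
  exact: (graded_sub_comb0 hN).
by move=> gv; split; rewrite // -raddf_comb gv linear0.
Qed.

Lemma linear_to_iso n : linear_to n N -> linear_to n N'.
Proof.
case: n => [|n] /= [b [g [gg hs]]]; exists b, (f \o g); split=> //.
- exact: generators_iso.
- exact: generators_iso.
- by rewrite syz_iso //; case: gg.
Qed.

End Isomorphism.

Lemma linear_to_gens n (V : lmodType R) (N : nat -> set V) :
  linear_to n N -> exists b (g : 'I_b -> V), generators N g.
Proof. by case: n => [|n] /= [b [g [gg _]]]; exists b, g. Qed.

(** Horseshoe construction.  The generators of N1, together with lifts to N2 of
    those of N3, generate N2, and their syzygies are an extension of the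
    syzygies of the third module by those of the first. *)
Section Extension.
Context (V W : lmodType R) (f : {linear V -> W}).
Context (N1 N2 : nat -> set V) (N3 : nat -> set W).
Hypotheses (h2 : graded_sub N2) (hf : short_exact f N1 N2 N3).
Context b1 (g1 : 'I_b1 -> V) b3 (h3 : 'I_b3 -> V).
Hypotheses (gg1 : generators N1 g1) (gg3 : generators N3 (f \o h3))
  (Nh3 : forall a, N2 0 (h3 a)).

Let fg1 v : f (comb g1 v) = 0.
Proof.
rewrite raddf_comb /comb big1 // => a _ /=; case: gg1 => /(_ a) N1g _ _.
by case: (hf 0) => /(_ (g1 a)) [+ _] _ _ => /(_ N1g) [_ ->]; rewrite scaler0.
Qed.

Lemma generators_ext : generators N2 (glue g1 h3).
Proof.
case: gg1 gg3 => N1g ind1 gen1 [_ ind3 gen3]; split.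
- move=> a; rewrite /glue; case: (split a) => i //.
  by case: (hf 0) => /(_ (g1 i)) [+ _] _ _ => /(_ (N1g i)) [].
- move=> c; rewrite -[c]hsubmxK map_row_mx comb_glue => c0.
  have c3 : rsubmx c = 0.
    by apply: ind3; rewrite -raddf_comb -(linear0 f) -c0 linearD /= fg1 add0r.
  rewrite c3 map_mx0 linear0 addr0 in c0.
  by rewrite (ind1 _ c0) c3 row_mx0.
- move=> j x Nx; have [hk hs _] := hf j.
  have [w hw fw] := gen3 _ _ (hs _ Nx); rewrite -raddf_comb in fw.
  have /hk/gen1 [v hv gv] : N2 j (x - comb h3 w) /\ f (x - comb h3 w) = 0.
    split; last by rewrite linearB /= fw subrr.
    by case: (h2 j) => _ + _; apply => //; apply: (graded_sub_comb0 h2).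
  exists (row_mx v w); first exact: homog_row_mx.
  by rewrite comb_glue gv subrK.
Qed.

Lemma syz_ext : exists2 N1' : nat -> set 'rV[R]_(b1 + b3),
  short_exact (mulmxr (row_mx 1%:M 0)) (fun=> [set 0]) (syz g1) N1' &
  short_exact (mulmxr (col_mx 0 1%:M)) N1' (syz (glue g1 h3)) (syz (f \o h3)).
Proof.
exists (fun j => [set v | syz (glue g1 h3) j v /\ rsubmx v = 0]).
  move=> j; split=> [v|v [hv gv]|v [[hv gv] v0]].
  - rewrite /= mul_inl; split=> [->|[_ v0]].
      by rewrite row_mx0; split=> //; case: (graded_syz g1 j).
    by rewrite -[v](row_mxKl _ (0 : 'rV_b3)) v0 linear0.
  - rewrite /= mul_inl; split; last by rewrite row_mxKr.
    split; last by rewrite comb_glue gv linear0 addr0.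
    by apply: homog_row_mx => //; apply: homog0.
  - exists (lsubmx v); last by rewrite /= mul_inl -[RHS]hsubmxK v0.
    split; first exact: homog_lsub.
    by rewrite -gv -{2}[v]hsubmxK comb_glue v0 linear0 addr0.
move=> j; split=> [v|v [hv]|w [hw]].
- by rewrite /= mul_projr.
- rewrite /= mul_projr -{1}[v]hsubmxK comb_glue => gv.
  split; first exact: homog_rsub.
  by rewrite -raddf_comb -(linear0 f) -gv linearD /= fg1 add0r.
- rewrite -raddf_comb => fw; have [hk _ _] := hf j.+1.
  case: gg1 => _ _ gen1.
  have /hk/gen1 [v hv gv] : N2 j.+1 (comb h3 w) /\ f (comb h3 w) = 0.
    by split=> //; apply: (graded_sub_comb0 h2).
  exists (row_mx (- v) w); last by rewrite /= mul_projr row_mxKr.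
  split; last by rewrite comb_glue linearN /= gv addNr.
  apply: homog_row_mx => // a; rewrite mxE; exact: gradedN.
Qed.

End Extension.

(** By induction on n through syz_ext.  The kernel of the projection onto the
    syzygies of N3 is only isomorphic to the syzygies of N1, which is where
    linear_to_iso enters. *)
Lemma linear_to_ext n : forall (V W : lmodType R) (f : {linear V -> W})
  (N1 N2 : nat -> set V) (N3 : nat -> set W),
  graded_sub N2 -> short_exact f N1 N2 N3 ->
  linear_to n N1 -> linear_to n N3 -> linear_to n N2.
Proof.
have lift (V W : lmodType R) (f : {linear V -> W}) N1 N2 N3 b (g : 'I_b -> W) :
    short_exact f N1 N2 N3 -> (forall a, N3 0 (g a)) ->
    exists2 h : 'I_b -> V, (forall a, N2 0 (h a)) & g = f \o h.
  move=> hf Ng; have hs a : exists x, N2 0 x /\ f x = g a.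
    by case: (hf 0) => _ _ /(_ _ (Ng a)) [x]; exists x.
  have [h hh] := choice hs; exists h => [a|]; first by case: (hh a).
  by apply/funext => a /=; case: (hh a).
elim: n => [|n IHn] V W f N1 N2 N3 h2 hf /= [b1 [g1 [gg1 s1]]] [b3 [g3 [gg3 s3]]].
  have [h3 Nh3 g3E] := lift _ _ _ _ _ _ _ _ hf (let: And3 h _ _ := gg3 in h).
  by subst g3; do 2!eexists; split=> //; apply: (generators_ext h2 hf gg1 gg3 Nh3).
have [h3 Nh3 g3E] := lift _ _ _ _ _ _ _ _ hf (let: And3 h _ _ := gg3 in h).
subst g3; do 2!eexists; split; first exact: (generators_ext h2 hf gg1 gg3 Nh3).
have [N1' e1 e2] := syz_ext h2 hf gg1 Nh3.
apply: (IHn _ _ _ _ _ _ (graded_syz _) e2 _ s3).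
exact: linear_to_iso (graded_syz g1) e1 _ s1.
Qed.

(** Two bases of N 0 differ by an invertible matrix over k, which has degree 0
    and therefore maps the syzygies of one basis isomorphically onto those of
    the other. *)
Lemma linear_to_basis n (V : lmodType R) (N : nat -> set V) b (h : 'I_b -> V) :
  linear_to n N -> kbasis (N 0) h ->
  generators N h /\ if n is n'.+1 then linear_to n' (syz h) else True.
Proof.
move=> hn hh; have [Nh genh indh] := hh.
have key c (g : 'I_c -> V) : generators N g -> generators N h /\
    exists Q : 'M[k]_(c, b),
      short_exact (mulmxr Q^K) (fun=> [set 0]) (syz g) (syz h).
  move=> gg; have [Ng geng indg] := generators_kbasis gg.
  have [P hP] := basis_change Ng genh; have [Q hQ] := basis_change Nh geng.
  have PQ := indep_change hP hQ indg; have QP := indep_change hQ hP indh.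
  split.
    split=> // j x Nx; case: gg => _ _ /(_ _ _ Nx) [v hv <-].
    by exists (v *m P^K); [apply: homog_mul_alg | rewrite -hP].
  exists P => j; split=> [v|v [hv gv]|w [hw gw]] /=.
  - split=> [->|[_ v0]].
      by rewrite mul0mx; split=> //; case: (graded_syz g j).
    by rewrite -[v]mulmx1 -(map_mx1 (in_alg R)) -PQ map_mxM mulmxA v0 mul0mx.
  - by split; [apply: homog_mul_alg | rewrite -hP].
  - exists (w *m Q^K).
      by split; [apply: homog_mul_alg | rewrite -hQ].
    by rewrite -mulmxA -map_mxM QP map_mx1 mulmx1.
case: n hn => [|n] /= [c [g [gg hs]]]; have [? [Q hQ]] := key _ _ gg; split=> //.
exact: linear_to_iso (graded_syz g) hQ _ hs.
Qed.

(** * Direct summands *)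

Section Retract.
Context (U V : lmodType R) (i : {linear U -> V}) (r : {linear V -> U}).
Context (A : nat -> set U) (N : nat -> set V).
Hypothesis hN : graded_sub N.
Hypotheses (hi : forall j x, A j x -> N j (i x))
  (hr : forall j y, N j y -> A j (r y)) (ri : forall x, r (i x) = x).

(** A basis of the component of degree 0 adapted to the splitting N = A + ker r;
    with such a basis, syzygies split in the same way. *)
Lemma kbasis_retract b (g : 'I_b -> V) : kbasis (N 0) g ->
  exists m n (u : 'I_m -> U) (z : 'I_n -> V),
    [/\ kbasis (A 0) u, forall a, r (z a) = 0
      & kbasis (N 0) (glue (i \o u) z)].
Proof.
move=> gg; have gN := let: And3 h _ _ := gg in h.
have AE : r @` N 0 = A 0.
  apply/predeqP => x; split=> [[y Ny <-]|Ax]; first exact: hr.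
  by exists (i x) => //; apply: hi.
have [c|n [m [z [w [_ kz Nw]]]]] := rank_nullity r _ gg.
  exact: (graded_sub_comb0 hN (homog_alg c)).
rewrite AE; set u := r \o w => ku; exists m, n, u, z.
have [Au genu indu] := ku; have [Nz genz indz] := kz.
have rz v : r (comb z v) = 0.
  rewrite raddf_comb /comb big1 // => a _ /=.
  by case: (Nz a) => _ ->; rewrite scaler0.
split=> // [a|]; first by case: (Nz a).
split=> [a|x Nx|c].
- rewrite /glue; case: split => a'; first by apply: hi; apply: Au.
  by case: (Nz a').
- have [c ec] := genu _ (hr Nx).
  have [|d ed] := genz (x - i (r x)).
    split; last by rewrite linearB /= ri subrr.
    by case: (hN 0) => _ + _; apply=> //; apply/hi/hr.
  exists (row_mx c d); rewrite map_row_mx comb_glue -raddf_comb -ec -ed.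
  by rewrite addrC subrK.
- rewrite -[c]hsubmxK map_row_mx comb_glue -raddf_comb => c0.
  have c1 : lsubmx c = 0.
    by apply: indu; rewrite -[LHS]addr0 -(rz (rsubmx c)^K) -[X in X + _]ri
      -linearD c0 linear0.
  rewrite c1 map_mx0 !linear0 add0r in c0.
  by rewrite (indz _ c0) c1 row_mx0.
Qed.

Lemma generators_retract m n (u : 'I_m -> U) (z : 'I_n -> V) :
  kbasis (A 0) u -> (forall a, r (z a) = 0) ->
  generators N (glue (i \o u) z) -> generators A u.
Proof.
move=> [Au _ indu] rz [_ _ gen]; split=> // j x Ax.
have [v hv] := gen _ _ (hi Ax); rewrite -[v]hsubmxK comb_glue -raddf_comb => e.
exists (lsubmx v); first exact: homog_lsub.
rewrite -[RHS]ri -e linearD /= ri [r (comb z _)]raddf_comb /comb.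
by rewrite [X in _ + X]big1 ?addr0 // => a _ /=; rewrite rz scaler0.
Qed.

Lemma syz_retract m n (u : 'I_m -> U) (z : 'I_n -> V) :
  (forall a, r (z a) = 0) ->
  (forall j v, syz u j v ->
     syz (glue (i \o u) z) j (mulmxr (row_mx 1%:M 0) v)) /\
  (forall j v, syz (glue (i \o u) z) j v ->
     syz u j (mulmxr (col_mx 1%:M 0) v)).
Proof.
move=> rz; split=> j v [hv].
  rewrite /= mul_inl => uv.
  split; first by apply: homog_row_mx => //; apply: homog0.
  by rewrite comb_glue -raddf_comb uv !linear0 addr0.
rewrite /= mul_projl -{1}[v]hsubmxK comb_glue -raddf_comb => e.
split; first exact: homog_lsub.
rewrite -[LHS]ri -[LHS]addr0 -[RHS](linear0 r) -e linearD /=; congr (_ + _).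
by rewrite raddf_comb /comb big1 // => a _ /=; rewrite rz scaler0.
Qed.

End Retract.

Lemma linear_to_retract n : forall (U V : lmodType R)
  (i : {linear U -> V}) (r : {linear V -> U}) (A : nat -> set U)
  (N : nat -> set V), graded_sub A -> graded_sub N ->
  (forall j x, A j x -> N j (i x)) -> (forall j y, N j y -> A j (r y)) ->
  (forall x, r (i x) = x) -> linear_to n N -> linear_to n A.
Proof.
elim: n => [|n IHn] U V i r A N hA hN hi hr ri hn;
  have [b [g /generators_kbasis gg]] := linear_to_gens hn;
  have [m [l [u [z [ku rz kN]]]]] := kbasis_retract hN hi hr ri gg;
  have [gN hs] := linear_to_basis hn kN; exists m, u; split=> //;
  try exact: generators_retract gN.
have [s1 s2] := syz_retract ri u rz.
apply: IHn s1 s2 _ hs; [exact: graded_syz | exact: graded_syz|].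
by move=> v; rewrite /= mul_inl mul_projl row_mxKl.
Qed.

(** The module (R_+)^q, shifted so as to start in degree 0.  It is the first
    syzygy module of k^q. *)
Definition irr_rows q (j : nat) : set 'rV[R]_q := [set v | homog j.+1 v].

Lemma graded_rows q : graded_sub (fun j => [set v : 'rV[R]_q | homog j v]).
Proof.
move=> j; split=> [|v w hv hw a|i r v hr hv a]; first exact: homog0.
  by rewrite !mxE; apply: gradedB.
by rewrite mxE; apply: gradedM.
Qed.

Lemma graded_shift (V : lmodType R) (N : nat -> set V) :
  graded_sub N -> graded_sub (fun j => N j.+1).
Proof.
move=> hN j; have [? ? hZ] := hN j.+1; split=> // i r x.
by rewrite -addnS; apply: hZ.
Qed.

Lemma graded_irr_rows q : graded_sub (@irr_rows q).
Proof. exact: graded_shift (@graded_rows q). Qed.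

(** R_+ is a direct summand of (R_+)^(p+1), and (R_+)^q is an iterated extension
    of copies of R_+.  The trivial module (R_+)^0 is a direct summand too. *)
Lemma linear_to_irr_rows n p q :
  linear_to n (@irr_rows p.+1) -> linear_to n (@irr_rows q).
Proof.
move=> hp; have h1 : linear_to n (@irr_rows 1).
  apply: (@linear_to_retract n _ _ (mulmxr (row_mx 1%:M (0 : 'M_(1, p))))
    (mulmxr (col_mx 1%:M 0)) _ _ _ _ _ _ _ hp) => [||j v hv|j v hv|v].
  - exact: graded_irr_rows.
  - exact: graded_irr_rows.
  - by rewrite /= mul_inl; apply: (@homog_row_mx 1 p) => //; apply: homog0.
  - by rewrite /= mul_projl; apply: (@homog_lsub 1 p).
  - by rewrite /= mul_inl mul_projl row_mxKl.
elim: q => [|q IHq].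
  apply: (@linear_to_retract n _ _ (mulmxr (0 : 'M_(0, 1)))
    (mulmxr (0 : 'M_(1, 0))) _ _ _ _ _ _ _ h1) => [||j v hv|j v hv a|v].
  - exact: graded_irr_rows.
  - exact: graded_irr_rows.
  - by rewrite /= mulmx0; apply: homog0.
  - by case: a.
  - by apply/rowP => -[].
pose N1 j : set 'rV[R]_(1 + q) := [set v | irr_rows j v /\ rsubmx v = 0].
apply: (@linear_to_ext n _ _ (mulmxr (col_mx 0 1%:M)) N1 (@irr_rows (1 + q))
  (@irr_rows q) (@graded_irr_rows _) _ _ IHq) => [j|].
  split=> [v|v hv|v hv]; first by rewrite /= mul_projr.
    by rewrite /= mul_projr; apply: (@homog_rsub 1 q).
  exists (row_mx 0 v); last by rewrite /= mul_projr row_mxKr.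
  by apply: (@homog_row_mx 1 q) => //; apply: homog0.
apply: (@linear_to_iso _ _ (mulmxr (row_mx 1%:M 0)) _ _ (@graded_irr_rows _)
  _ _ h1) => j; split=> [v|v hv|v [hv v0]].
- rewrite /= mul_inl; split=> [->|[_ v0]].
    by rewrite row_mx0; split=> //; case: (@graded_irr_rows 1 j).
  by rewrite -[v](row_mxKl _ (0 : 'rV_q)) v0 linear0.
- rewrite /= mul_inl; split; last by rewrite row_mxKr.
  by apply: (@homog_row_mx 1 q) => //; apply: homog0.
- exists (lsubmx v); first exact: (@homog_lsub 1 q).
  by rewrite /= mul_inl -[RHS]hsubmxK v0.
Qed.

(** A module with a single component is a sum of copies of k, so all rows with
    coefficients in R_+ are syzygies. *)
Lemma linear_to_concentrated n (V : lmodType R) (N : nat -> set V) b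
  (g : 'I_b -> V) : graded_sub N -> kbasis (N 0) g ->
  (forall j x, N j.+1 x -> x = 0) ->
  (if n is n'.+1 then linear_to n' (@irr_rows b) else True) -> linear_to n N.
Proof.
move=> hN [Ng gen ind] N0 hn.
have gg : generators N g.
  split=> // -[|j] x Nx.
    by have [c ->] := gen _ Nx; exists c^K => //; apply: homog_alg.
  by exists 0; [apply: homog0 | rewrite linear0 (N0 _ _ Nx)].
have sE : syz g = @irr_rows b.
  apply/funext => j; apply/predeqP => v; split=> [[]//|hv]; split=> //.
  exact: N0 (graded_sub_comb0 hN hv Ng).
by case: n hn => [|n] hn; exists b, g; rewrite ?sE.
Qed.

(** The induction that transfers linearity from a module N with components in
    degrees 0 and 1 to R_+.  The sequence 0 -> syz g -> (R_+)^b -> N_1 -> 0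
    gains one step, because N_1 is linear one step further than (R_+)^c. *)
Lemma linear_to_irr_rows_of_module (V : lmodType R) (N : nat -> set V)
  b (g : 'I_b -> V) c (h : 'I_c -> V) :
  (0 < b)%N -> graded_sub N -> generators N g ->
  (forall j x, N j.+2 x -> x = 0) -> kbasis (N 1) h ->
  (forall n, linear_to n (syz g)) -> forall n q, linear_to n (@irr_rows q).
Proof.
case: b g => // b g _ hN gg N0 kh hs n; have [Ng _ gen] := gg.
pose N' j := N j.+1.
have hN' : graded_sub N' := graded_shift hN.
have ex : short_exact (comb g) (syz g) (@irr_rows b.+1) N'.
  move=> j; split=> [v|v hv|x Nx].
  - by split=> -[hv gv]; split.
  - by have := graded_sub_comb0 hN hv Ng.
  - by have [v hv <-] := gen _ _ Nx; exists v.
elim: n => [|n IHn] q; apply: linear_to_irr_rows;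
  apply: (linear_to_ext (@graded_irr_rows _) ex (hs _));
  by apply: (linear_to_concentrated hN' kh N0).
Qed.

(** * Decomposition into homogeneous components *)

Lemma graded_sub_ring : graded_sub (gR : nat -> set R^o).
Proof.
move=> j; split=> [|x y|i r x hr hx]; first exact: graded0.
  exact: gradedB.
exact: gradedM.
Qed.

Definition graded_indep (V : lmodType R) (N : nat -> set V) : Prop :=
  forall n (f : nat -> V), (forall j, N j (f j)) -> \sum_(j < n) f j = 0 ->
  forall j, (j < n)%N -> f j = 0.

Lemma graded_indep_ring : graded_indep (gR : nat -> set R^o).
Proof.
move=> n f hf f0 j jn; case: hR => [[_ _ h] _ _ _].
apply: (h (index_iota 0 n) f (iota_uniq _ _) hf).
  by rewrite big_mkord.
by rewrite mem_index_iota.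
Qed.

(** The shift s accounts for syzygies, whose component j has coefficients of
    degree j + 1. *)
Lemma graded_indep_rows b (N : nat -> set 'rV[R]_b) (s : nat) :
  (forall j v, N j v -> homog (s + j) v) -> graded_indep N.
Proof.
move=> hN n f hf f0 j jn; apply/rowP => a; rewrite mxE.
pose F i := if (i < s)%N then 0 else f (i - s)%N 0 a.
have := @graded_indep_ring (s + n) F _ _ (s + j)%N.
rewrite /F ltn_add2l jn ltnNge leq_addr /= addKn; apply=> // [i|].
  case: ltnP => hi; first exact: graded0.
  by have := hN _ _ (hf (i - s)%N) a; rewrite subnKC.
rewrite big_split_ord /= big1 ?add0r => [|i _]; last by rewrite ltn_ord.
move/rowP: f0 => /(_ a); rewrite summxE mxE => f0; rewrite -[RHS]f0.
by apply: eq_bigr => i _; rewrite ltnNge leq_addr /= addKn.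
Qed.

Lemma elt_decomp (r : R) : exists p : nat * (nat -> R),
  (forall j, gR j (p.2 j)) /\ forall n, (p.1 <= n)%N -> r = \sum_(j < n) p.2 j.
Proof.
case: hR => [[_ h _] _ _ _]; have [s [f [hf ->]]] := h r.
(* The indices in s may repeat: terms with the same index are added up. *)
exists ((\max_(i <- s) i).+1, fun j => \sum_(i <- s | i == j) f i); split=> /=.
  by move=> j; apply: graded_sum => i /eqP <-.
move=> n hn; rewrite (exchange_big_dep predT) //= big_seq [RHS]big_seq.
apply: eq_bigr => i hi; have ni : (i < n)%N.
  by apply: leq_trans hn; rewrite ltnS; apply: (@leq_bigmax_seq _ _ xpredT).
by rewrite (big_pred1 (Ordinal ni)) // => j; rewrite eq_sym.
Qed.

Lemma row_decomp b (v : 'rV[R]_b) : exists (m : nat) (f : nat -> 'rV[R]_b),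
  (forall j, homog j (f j)) /\ forall n, (m <= n)%N -> v = \sum_(j < n) f j.
Proof.
have [p hp] := choice (fun a => elt_decomp (v 0 a)).
exists (\max_a (p a).1)%N, (fun j => \row_a (p a).2 j); split=> [j a|n hn].
  by rewrite mxE; case: (hp a).
apply/rowP => a; rewrite summxE; have [_ h] := hp a.
rewrite {1}(h n) => [|]; first by apply: eq_bigr => j _; rewrite mxE.
by apply: leq_trans hn; apply: leq_bigmax.
Qed.

(** Only the component of degree j of v contributes to an element of N_j. *)
Lemma homog_lift (V : lmodType R) (N : nat -> set V) b (g : 'I_b -> V) j v :
  graded_sub N -> graded_indep N -> (forall a, N 0 (g a)) -> N j (comb g v) ->
  exists2 w, homog j w & comb g w = comb g v.
Proof.
move=> hN ind Ng Nv.
have [m [f [hf /(_ (m + j.+1)%N (leq_addr _ _)) e]]] := row_decomp v.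
exists (f j) => //; apply/eqP; rewrite -subr_eq0; apply/eqP.
have := ind (m + j.+1)%N
  (fun i => comb g (f i) - (if i == j then comb g v else 0)) _ _ j.
rewrite eqxx; apply=> [i||]; last by rewrite addnS ltnS leq_addl.
  have [_ hB _] := hN i; apply: hB; first exact: (graded_sub_comb0 hN).
  by case: eqP => [->|_] //; case: (hN i).
have jn : (j < m + j.+1)%N by rewrite addnS ltnS leq_addl.
rewrite sumrB -linear_sum -e -big_mkcond (big_pred1 (Ordinal jn)) ?subrr //.
Qed.

(** Homogeneous components of a relation are relations; the one of degree 0
    has coefficients in k and vanishes, as g is independent over k.  This turns
    degreewise statements about syz into exactness of ungraded sequences. *)
Lemma syz_decomp (V : lmodType R) (N : nat -> set V) b (g : 'I_b -> V) v :
  graded_sub N -> graded_indep N -> generators N g -> comb g v = 0 ->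
  exists (m : nat) (f : nat -> 'rV[R]_b),
    (forall j, syz g j (f j)) /\ v = \sum_(j < m) f j.
Proof.
move=> hN ind [Ng indg _] gv.
have [m [f [hf /(_ m.+1 (leqnSn _)) e]]] := row_decomp v.
have gf j : (j < m.+1)%N -> comb g (f j) = 0.
  apply: (ind m.+1 (fun i => comb g (f i))) => [i|].
    exact: (graded_sub_comb0 hN).
  by rewrite -linear_sum -e.
have f0 : f 0%N = 0.
  have [c ec] := homog_scalar (hf 0%N); rewrite ec (indg c) ?map_mx0 //.
  by rewrite -ec gf.
exists m, (fun j => if (j < m)%N then f j.+1 else 0); split=> [j|].
  case: ltnP => jm; first by split=> //; apply: gf.
  by case: (graded_syz g j).
by rewrite {1}e big_ord_recl f0 add0r; apply: eq_bigr => i _; rewrite ltn_ord.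
Qed.

(** * Components of R have finite rank *)

(** The rows with entries in U correspond to the b x h matrices of coordinates
    of their entries; these matrices are flattened to index the basis. *)
Lemma kbasis_power (U : set R^o) h (x : 'I_h -> R^o) b : kbasis U x ->
  (forall c : 'rV[k]_h, U (comb x c^K)) ->
  exists G : 'I_(b * h) -> 'rV[R]_b,
    kbasis [set v : 'rV[R]_b | forall a, U (v 0 a)] G.
Proof.
move=> [Ux gen ind] Uc; pose X : 'cV[R]_h := \col_l x l.
pose G l : 'rV[R]_b := (vec_mx (delta_mx 0 l) *m X)^T.
have GE (c : 'M[k]_(b, h)) : comb G (mxvec c)^K = \row_a comb x (row a c)^K.
  rewrite {1}/comb /G.
  transitivity ((c^K *m X)^T).
    rewrite -{2}[c]mxvecK map_vec_mx [(mxvec c)^K in RHS]row_sum_delta.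
    rewrite linear_sum mulmx_suml linear_sum; apply: eq_bigr => l _.
    by rewrite linearZ -scalemxAl linearZ.
  apply/rowP => a; rewrite !mxE; apply: eq_bigr => l _.
  by rewrite !mxE.
exists G; split=> [l a|v hv|c].
- have : comb G (mxvec (vec_mx (delta_mx 0 l : 'rV[k]_(b * h))))^K = G l.
    by rewrite vec_mxK map_delta_mx comb_delta.
  by rewrite GE => <-; rewrite mxE.
- have [C hC] := choice (fun a => gen _ (hv a)).
  exists (mxvec (\matrix_(a, l) C a 0 l)); rewrite GE; apply/rowP => a.
  rewrite mxE hC; congr (comb x _); apply/rowP => l; by rewrite !mxE.
- rewrite -[c]vec_mxK GE => /rowP c0; suff -> : vec_mx c = 0 by rewrite linear0.
  by apply/row_matrixP => a; rewrite row0; apply: ind; have := c0 a; rewrite !mxE.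
Qed.

(** The combinations of the monomials of degree j in x. *)
Fixpoint monomial_span n (x : 'I_n -> R) (j : nat) : set R :=
  if j is j'.+1 then
    [set r | exists2 t : 'I_n -> R, (forall i, monomial_span x j' (t i)) &
             r = \sum_i t i * x i]
  else range (fun c : k => c%:A).

Section Monomials.
Context n (x : 'I_n -> R) (hx : forall i, gR 1%N (x i)).
Let T := monomial_span x.

Lemma monomial_spanP j c u v : T j u -> T j v -> T j (c *: u + v).
Proof.
elim: j u v => [|j IHj] u v.
  by move=> [a _ <-] [b _ <-]; exists (c * a + b); rewrite // scalerDl scalerA.
move=> [t ht ->] [s hs ->]; exists (fun i => c *: t i + s i).
  by move=> i; apply: (IHj _ _ (ht i) (hs i)).
rewrite scaler_sumr -big_split; apply: eq_bigr => i _ /=.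
by rewrite mulrDl scalerAl.
Qed.

Lemma monomial_span0 j : T j 0.
Proof.
elim: j => [|j IHj]; first by exists 0 => //; rewrite scale0r.
by exists (fun=> 0) => //; rewrite big1 // => i _; rewrite mul0r.
Qed.

Lemma monomial_spanM i j u v : T i u -> T j v -> T (i + j)%N (u * v).
Proof.
elim: i u => [|i IHi] u.
  move=> [c _ <-] hv; rewrite mulr_algl -[_ *: v]addr0.
  exact: monomial_spanP hv (monomial_span0 j).
move=> [t ht ->] hv; exists (fun l => t l * v) => [l|].
  exact: IHi (ht l) hv.
by rewrite mulr_suml; apply: eq_bigr => l _; rewrite mulrAC.
Qed.

Lemma monomial_span_graded j u : T j u -> gR j u.
Proof.
elim: j u => [|j IHj] u; first by move=> [c _ <-]; apply: graded_alg.
move=> [t ht ->]; apply: graded_sum => i _.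
by rewrite -addn1; apply: gradedM; [apply: IHj (ht i) | apply: hx].
Qed.

Definition monomial_sums : {pred R} := fun r =>
  `[< exists m (f : nat -> R), (forall j, T j (f j)) /\ r = \sum_(j < m) f j >].

Lemma monomial_sums_span j u : T j u -> u \in monomial_sums.
Proof.
move=> hu; apply/asboolP; exists j.+1, (fun i => if i == j then u else 0).
split=> [i|]; first by case: eqP => [->|_] //; apply: monomial_span0.
rewrite big_ord_recr /= eqxx big1 ?add0r // => i _.
by rewrite ltn_eqF.
Qed.

Lemma monomial_sumsP c u v :
  u \in monomial_sums -> v \in monomial_sums -> c *: u + v \in monomial_sums.
Proof.
move=> /asboolP [m [f [hf ->]]] /asboolP [l [g [hg ->]]]; apply/asboolP.
exists (maxn m l), (fun j => c *: (if (j < m)%N then f j else 0) +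
                             (if (j < l)%N then g j else 0)); split=> [j|].
  by apply: monomial_spanP; case: ifP => // _; apply: monomial_span0.
rewrite big_split /= -scaler_sumr -!big_mkcond.
by rewrite -!big_ord_widen ?leq_maxl ?leq_maxr.
Qed.

Lemma monomial_sums_subalg : subalg_closed monomial_sums.
Proof.
have S0 : 0 \in monomial_sums by apply: (monomial_sums_span (monomial_span0 0)).
have SD u v : u \in monomial_sums -> v \in monomial_sums -> u + v \in monomial_sums.
  by move=> hu hv; rewrite -[u]scale1r; apply: monomial_sumsP.
split=> [|c u v|u v].
  by apply: (@monomial_sums_span 0); exists 1; rewrite ?scale1r.
  exact: monomial_sumsP.
move=> /asboolP [m [f [hf ->]]] /asboolP [l [g [hg ->]]].
rewrite mulr_suml; apply: (big_ind (fun r => r \in monomial_sums)) => // i _.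
rewrite mulr_sumr; apply: (big_ind (fun r => r \in monomial_sums)) => // j _.
exact: monomial_sums_span (monomial_spanM (hf i) (hg j)).
Qed.

Lemma monomial_sums_gen i : x i \in monomial_sums.
Proof.
apply: (@monomial_sums_span 1); exists (fun l => (l == i)%:R%:A) => [l|].
  by exists (l == i)%:R.
rewrite (bigD1 i) //= eqxx scale1r mul1r big1 ?addr0 // => l /negbTE ->.
by rewrite scale0r mul0r.
Qed.

(** Sums of combinations of monomials form a subalgebra containing the
    generators x, hence are everything; comparing components of degree j leaves
    no room for other elements in R_j. *)
Lemma graded_monomial_span : (forall r, r \in monomial_sums) -> gR = T.
Proof.
move=> hgen; apply/funext => j; apply/predeqP => r; split; last first.
  exact: monomial_span_graded.
move=> hr; have /asboolP [m [f [hf e]]] := hgen r.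
have jm : (j < maxn m j.+1)%N by rewrite leq_maxr.
(* Padding m to exceed j makes the component of degree j visible. *)
pose F i := (if (i < m)%N then f i else 0) - (if i == j then r else 0).
have : F j = 0.
  apply: (graded_indep_ring (n := maxn m j.+1)) => // [i|].
    apply: (gradedB hR); last by case: eqP => [->|_] //; apply: graded0.
    case: ifP => _; last exact: graded0.
    exact: monomial_span_graded (hf i).
  rewrite sumrB -!big_mkcond -(big_ord_widen _ f) ?leq_maxl // -e.
  by rewrite (big_pred1 (Ordinal jm)) ?subrr.
rewrite /F eqxx => /eqP; rewrite subr_eq0 => /eqP <-.
by case: ifP => _ //; apply: monomial_span0.
Qed.

End Monomials.

Lemma kbasis_scalars : kbasis (gR 0%N : set R^o) (fun _ : 'I_1 => 1 : R^o).
Proof.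
split=> [_|r /graded_scalar [c ->]|c].
- by have := graded_alg 1; rewrite scale1r.
- exists (const_mx c); rewrite /comb big_ord1 !mxE.
  by rewrite /GRing.scale /= mulr1.
- rewrite /comb big_ord1 mxE /GRing.scale /= mulr1 => c0.
  have {}c0 : (c 0 0)%:A = 0 :> R by [].
  apply/rowP => i; rewrite mxE ord1; apply: (irrelevant_scalar hR).
  by rewrite c0; apply: irrelevant0.
Qed.

Lemma ring_kbasis j : exists h (x : 'I_h -> R^o), kbasis (gR j : set R^o) x.
Proof.
have [_ _ h0 [n [x [hx hgen]]]] := hR.
have TE := graded_monomial_span hx
  (hgen _ (monomial_sums_subalg x) (monomial_sums_gen x)).
elim: j => [|j [h [u ku]]].
  by exists 1%N, (fun=> 1); apply: kbasis_scalars.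
have [|G kG] := kbasis_power n ku.
  by move=> c; apply: (graded_sub_comb graded_sub_ring (homog_alg c)); case: ku.
have [|_ [m [_ [w [_ _ _ kw]]]]] := rank_nullity (comb (x : 'I_n -> R^o)) _ kG.
  by move=> c; apply: (graded_sub_comb (@graded_rows n) (homog_alg c)); case: kG.
exists m, (comb (x : 'I_n -> R^o) \o w).
rewrite (_ : gR j.+1 =
  comb (x : 'I_n -> R^o) @` [set v : 'rV[R]_n | forall a, gR j (v 0 a)]) //.
apply/predeqP => r; rewrite TE; split=> [[t ht ->]|[v hv <-]].
  exists (\row_i t i) => [a|]; first by rewrite mxE; apply: ht.
  by apply: eq_bigr => i _; rewrite mxE.
by exists (v 0).
Qed.

(** Ranks in the exact sequence 0 -> syz(g)_j -> (R_(j+1))^b -> N_(j+1) -> 0. *)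
Lemma generators_rank (V : lmodType R) (N : nat -> set V) b (g : 'I_b -> V) j :
  graded_sub N -> generators N g ->
  exists n m (z : 'I_n -> 'rV[R]_b) (w : 'I_m -> V),
    [/\ kbasis (syz g j) z, kbasis (N j.+1) w
      & (n + m)%N = (b * krank (gR j.+1 : set R^o))%N].
Proof.
move=> hN [Ng _ gen]; have [h [x kx]] := ring_kbasis j.+1.
rewrite (krankE (kbasis_krank kx)); have [|G kG] := kbasis_power b kx.
  by move=> c; apply: (graded_sub_comb graded_sub_ring (homog_alg c)); case: kx.
have [|n [m [z [w [<- kz _ kw]]]]] := rank_nullity (comb g) _ kG.
  by move=> c; apply: (graded_sub_comb (@graded_rows b) (homog_alg c)); case: kG.
exists n, m, z, (comb g \o w); split=> //.
rewrite (_ : N j.+1 =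
  comb g @` [set v : 'rV[R]_b | forall a, gR j.+1 (v 0 a)]) //.
apply/predeqP => y; split=> [/gen [v hv <-]|[v hv <-]]; first by exists v.
exact: (graded_sub_comb0 hN).
Qed.

(** * A linear resolution of k *)

Lemma comb_sum_gens (V : lmodType R) (N : nat -> set V) b (g : 'I_b -> V) m
  (f : nat -> V) : generators N g -> (forall j, N j (f j)) ->
  exists w, comb g w = \sum_(j < m) f j.
Proof.
move=> [_ _ gen] hf.
have hw j : exists w, comb g w = f j by have [w _ <-] := gen _ _ (hf j); exists w.
have [w {}hw] := choice hw; exists (\sum_(j < m) w j); rewrite linear_sum.
by apply: eq_bigr => j _; apply: hw.
Qed.

Section Resolution.
Hypothesis linR : forall n q, linear_to n (@irr_rows q).

(** A step of the resolution under construction: a module linear up to every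
    order, given as a submodule of the free module of the previous step.  As
    linear_to_basis holds for every basis, any choice of generators leads to
    a new stage. *)
Record stage := Stage {
  srank : nat;
  smod : nat -> set 'rV[R]_srank;
  sgraded : graded_sub smod;
  shomog : forall j v, smod j v -> homog j.+1 v;
  slinear : forall n, linear_to n smod
}.

Lemma stage_gens (s : stage) : exists p : {b & 'I_b -> 'rV[R]_(srank s)},
  generators (@smod s) (projT2 p) /\ forall n, linear_to n (syz (projT2 p)).
Proof.
have [b [g gg]] := linear_to_gens (slinear s 0).
exists (existT _ b g); split=> //= n.
by have [_] := linear_to_basis (slinear s n.+1) (generators_kbasis gg).
Qed.

Definition gens s := projT2 (projT1 (cid (stage_gens s))).

Lemma gensP s : generators (@smod s) (@gens s).
Proof. by have [] := projT2 (cid (stage_gens s)). Qed.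

Definition next_stage s : stage :=
  @Stage _ (syz (@gens s)) (graded_syz _) (fun j v h => proj1 h)
    (proj2 (projT2 (cid (stage_gens s)))).

Definition stage0 : stage :=
  @Stage 1 (@irr_rows 1) (@graded_irr_rows 1) (fun j v h => h) (linR ^~ 1%N).

Definition stages i := iter i next_stage stage0.

Definition sdiff s : 'M[R]_(srank (next_stage s), srank s) :=
  \matrix_a gens a.

Lemma mul_sdiff s v : v *m sdiff s = comb (@gens s) v.
Proof. by rewrite -comb_rows; apply: eq_comb => a; rewrite rowK. Qed.

Lemma sdiff_homog s a b : gR 1 (sdiff s a b).
Proof. by rewrite mxE; have [h _ _] := gensP s; apply: shomog (h a) b. Qed.

Lemma sdiff_exact s (v : 'rV[R]_(srank (next_stage s))) :
  v *m sdiff s = 0 <-> exists w, v = w *m sdiff (next_stage s).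
Proof.
have gind : graded_indep (@smod s) by apply: (@graded_indep_rows _ _ 1 (@shomog s)).
split=> [|[w ->]]; rewrite mul_sdiff.
  move=> /(syz_decomp (sgraded s) gind (gensP s)) [m [f [hf ->]]].
  have [w <-] := comb_sum_gens m (gensP (next_stage s)) hf.
  by exists w; rewrite mul_sdiff.
rewrite mul_sdiff raddf_comb /comb big1 // => a _ /=.
by have [/(_ a) [_ ->] _ _] := gensP (next_stage s); rewrite scaler0.
Qed.

(** The first differential presents R_+, the kernel of R -> k. *)
Lemma sdiff_exact0 (v : 'rV[R]_1) :
  augmentation gR (v 0 0) = 0 <-> exists w, v = w *m sdiff stage0.
Proof.
split=> [v0|[w ->]].
  have := augmentationP hR (v 0 0); rewrite v0 scale0r subr0 => -[m [f [hf e]]].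
  have [//|w hw] := comb_sum_gens (f := fun j => const_mx (f j.+1)) m.-1
    (gensP stage0).
    by move=> j a; rewrite mxE.
  exists w; rewrite mul_sdiff hw; apply/rowP => a; rewrite ord1 e summxE.
  case: m {e w hw} => [|m]; first by rewrite big_geq // big_ord0.
  by rewrite big_add1 big_mkord; apply: eq_bigr => j _; rewrite mxE.
apply: (augmentationE hR); rewrite scale0r subr0 mxE.
apply: (big_ind _ (irrelevant0 hR) (irrelevantD hR)) => a _.
by apply: (irrelevantM hR); apply: (irrelevant_homog hR) (sdiff_homog _ _).
Qed.

Lemma koszul_of_linear : koszul_algebra hR.
Proof.
pose rk i := srank (stages i).
pose dg i (a : 'I_(rk i)) : int := i%:Z.
pose df i : 'M[R]_(rk i.+1, rk i) := sdiff (stages i).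
pose ag (a : 'I_(rk 0%N)) : residue_field hR := (1 : k).
have augE (v : 'rV[R]_(rk 0%N)) :
    \sum_a v 0 a *: ag a = augmentation gR (v 0 0) :> k.
  by rewrite big_ord1 /ag /GRing.scale /= /residue_scale mulr1.
have F : exists F : min_free_resolution gR (residue_grading (hR := hR)),
    forall i a, @res_deg _ _ _ _ _ F i a = i%:Z.
  unshelve eexists (@MinFreeRes _ _ _ _ _ rk dg df ag _ _ _ _ _ _) => //.
  - move=> i a b; rewrite (_ : dg _ a - dg _ b = 1%N); last first.
      by rewrite /dg intS addrK.
    exact: sdiff_homog.
  - move=> m; exists (const_mx (m : k)%:A); rewrite augE mxE.
    apply/esym/(augmentationE hR); rewrite subrr; exact: irrelevant0.
  - by move=> v; rewrite augE; apply: sdiff_exact0.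
  - by move=> i v; apply: sdiff_exact.
  - by move=> i a b; apply: (irrelevant_homog hR) (sdiff_homog _ _).
have [{}F hF] := F.
exists (fun i j => #|[set a : 'I_(res_rank F i) | res_deg a == j]%SET|).
  by exists F.
exists 0 => i j ij; apply: eq_card0 => a; rewrite inE hF.
by apply/negbTE/eqP => e; apply: ij; rewrite -e subrr.
Qed.

End Resolution.

(** * Analysis of a given minimal resolution *)

Definition minimal (V : lmodType R) b (g : 'I_b -> V) : Prop :=
  forall v, comb g v = 0 -> forall a, irrelevant gR (v 0 a).

Lemma irrelevant1 : ~ irrelevant gR 1.
Proof.
rewrite -[1]scale1r => /(irrelevant_scalar hR) e.
by have := oner_neq0 k; rewrite e eqxx.
Qed.

Lemma minimal_neq0 (V : lmodType R) b (g : 'I_b -> V) a : minimal g -> g a <> 0.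
Proof.
move=> ming g0; apply: irrelevant1.
by have := ming (delta_mx 0 a); rewrite comb_delta => /(_ g0 a); rewrite mxE !eqxx.
Qed.

Lemma minimal_indep (V : lmodType R) b (g : 'I_b -> V) (c : 'rV[k]_b) :
  minimal g -> comb g c^K = 0 -> c = 0.
Proof.
move=> ming /ming irr; apply/rowP => a; rewrite mxE.
by apply: (irrelevant_scalar hR); have := irr a; rewrite mxE.
Qed.

Lemma minimal_generators (V : lmodType R) (N : nat -> set V) b (g : 'I_b -> V) :
  graded_sub N -> graded_indep N -> (forall a, N 0 (g a)) -> minimal g ->
  (forall j x, N j x -> exists v, x = comb g v) -> generators N g.
Proof.
move=> hN ind Ng ming gen; split=> // [c|j x Nx]; first exact: minimal_indep.
by have [v e] := gen _ _ Nx; subst x; apply: homog_lift.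
Qed.

(** A minimal generating family of a module generated in degree 0 lies in degree
    0.  If t a > 0, then h_a is a combination of elements of degree 0 with
    coefficients in R_+; rewriting these elements in terms of h gives a
    relation whose coefficient at a is 1 modulo R_+, against minimality. *)
Lemma minimal_degrees (V : lmodType R) (N : nat -> set V) b (h : 'I_b -> V)
  (t : 'I_b -> nat) : linear_to 0 N -> (forall a, N (t a) (h a)) ->
  minimal h -> (forall x, N 0 x -> exists v, x = comb h v) ->
  forall a, t a = 0%N.
Proof.
move=> /linear_to_gens [q [g [Ng _ gen]]] hN minh genh a.
case: (posnP (t a)) => // ta0; exfalso.
have [w hw wE] := gen _ _ (hN a).
have [v vE] := choice (fun c => genh _ (Ng c)).
pose P := \matrix_c v c.
have PE : comb g w = comb h (w *m P).
  by rewrite comb_mulmx; apply: eq_comb => c; rewrite rowK -vE.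
have := minh (delta_mx 0 a - w *m P).
(* The coefficient at a is 1 minus an element of R_+. *)
rewrite linearB /= comb_delta -PE wE subrr => /(_ erefl a).
rewrite !mxE !eqxx => h1; apply: irrelevant1.
rewrite -(subrK (\sum_j w 0 j * P j a) 1); apply: (irrelevantD hR) h1 _.
apply: (big_ind _ (irrelevant0 hR) (irrelevantD hR)) => c _.
rewrite mulrC; apply: (irrelevantM hR); exact: (irrelevant_homog hR) (hw c).
Qed.

Section GivenModule.
Context (M : lmodType R) (gM : int -> set M) (hM : graded_module gR gM).

Definition nonneg_part (j : nat) : set M := gM (Posz j).

Lemma graded_nonneg_part : graded_sub nonneg_part.
Proof.
case: hM => [[h _ _] hZ] j; split; try by case: (h j).
by move=> i r x hr hx; rewrite /nonneg_part PoszD; apply: hZ.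
Qed.

Lemma graded_indep_nonneg_part : graded_indep nonneg_part.
Proof.
move=> n f hf f0 j jn; case: hM => [[h _ ind] _].
pose F (i : int) := if i is Posz i' then f i' else 0.
have := ind (map Posz (index_iota 0 n)) F _ _ _ (Posz j); rewrite /F; apply.
- by rewrite map_inj_uniq ?iota_uniq // => x y [].
- by case=> [i|i]; [apply: hf | case: (h (Negz i))].
- by rewrite big_map big_mkord.
- by rewrite mem_map ?mem_index_iota // => x y [].
Qed.

Section GivenResolution.
Variable F : min_free_resolution gR gM.

Definition diff_row i (a : 'I_(res_rank F i.+1)) := row a (res_diff F i).
Arguments diff_row : clear implicits.

(** The component of degree i + 1 + j of the image of F_(i+1) in F_i, for a
    resolution that is linear and starts in degree 0. *)
Definition diff_image i (j : nat) : set 'rV[R]_(res_rank F i) :=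
  [set v | homog j.+1 v /\ exists w, v = w *m res_diff F i].
Arguments diff_image : clear implicits.

Lemma minimal_aug : minimal (@res_aug _ _ _ _ _ F).
Proof.
move=> v /res_exact0 [w ->] a; rewrite mxE.
apply: (big_ind _ (irrelevant0 hR) (irrelevantD hR)) => c _.
by apply: (irrelevantM hR); apply: res_minimal.
Qed.

Lemma minimal_diff_row i : minimal (diff_row i).
Proof.
move=> v; rewrite comb_rows => /res_exactS [w ->] a; rewrite mxE.
apply: (big_ind _ (irrelevant0 hR) (irrelevantD hR)) => c _.
by apply: (irrelevantM hR); apply: res_minimal.
Qed.

Lemma syz_aug : syz (@res_aug _ _ _ _ _ F) = diff_image 0.
Proof.
apply/funext => j; apply/predeqP => v.
by split=> -[hv] /res_exact0.
Qed.

Lemma syz_diff_row i : syz (diff_row i) = diff_image i.+1.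
Proof.
apply/funext => j; apply/predeqP => v; split=> -[hv]; rewrite ?comb_rows.
  by move=> /res_exactS.
by move=> /res_exactS gv; split; rewrite ?comb_rows.
Qed.

Lemma graded_diff_image i : graded_sub (diff_image i).
Proof. by case: i => [|i]; rewrite -?syz_aug -?syz_diff_row; apply: graded_syz. Qed.

Lemma graded_indep_diff_image i : graded_indep (diff_image i).
Proof. by apply: (@graded_indep_rows _ _ 1) => j v []. Qed.

Lemma diff_image_comb i j v :
  diff_image i j v -> exists w, v = comb (diff_row i) w.
Proof. by move=> [_ [w ->]]; exists w; rewrite comb_rows. Qed.

Lemma generators_diff_row i : (forall a, homog 1 (diff_row i a)) ->
  generators (diff_image i) (diff_row i).
Proof.
move=> hd; apply: minimal_generators (@diff_image_comb i).
- exact: graded_diff_image.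
- exact: graded_indep_diff_image.
- by move=> a; split=> //; exists (delta_mx 0 a); rewrite -rowE.
- exact: minimal_diff_row.
Qed.

Lemma linear_to_diff_image d :
  (forall i (a : 'I_(res_rank F i)), res_deg a = i%:Z + d) ->
  forall n i, linear_to n (diff_image i).
Proof.
move=> hd; have gd i : generators (diff_image i) (diff_row i).
  apply: generators_diff_row => a b; have := res_diff_homog a b.
  by rewrite !hd opprD addrACA subrr addr0 intS addrK mxE.
elim=> [|n IHn] i; exists (res_rank F i.+1), (diff_row i); split=> //.
by rewrite syz_diff_row.
Qed.

(** Linearity of M is witnessed by some minimal resolution, which need not be F.
    The two are not compared directly; minimal_degrees is applied along F:
    knowing that the syzygies of F are linear to all orders forces the next
    free module into a single degree, and linear_to_basis then says that the
    next syzygies are again linear. *)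
Lemma resolution_linear :
  (forall j : int, j <> 0 -> j <> 1 -> gM j = [set 0]) ->
  (forall n, linear_to n nonneg_part) ->
  [/\ forall i (a : 'I_(res_rank F i)), res_deg a = i%:Z,
      generators nonneg_part (@res_aug _ _ _ _ _ F)
    & forall i, generators (diff_image i) (diff_row i)].
Proof.
move=> hM01 linM.
have deg0 (a : 'I_(res_rank F 0)) : res_deg a = 0.
  have degP (b : 'I_(res_rank F 0)) : exists t : nat, res_deg b = t%:Z :> int.
    have := @minimal_neq0 _ _ _ b minimal_aug.
    have := @res_aug_homog _ _ _ _ _ F b.
    case: (res_deg b) => [t|t]; first by exists t.
    by rewrite hM01 // => ->.
  have [t ht] := choice degP.
  rewrite ht (minimal_degrees (linM 0%N) _ minimal_aug) // => [b|x _].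
    by rewrite /nonneg_part -ht; apply: res_aug_homog.
  exact: res_aug_surj.
have gaug : generators nonneg_part (@res_aug _ _ _ _ _ F).
  apply: minimal_generators => [|||| j x _].
  - exact: graded_nonneg_part.
  - exact: graded_indep_nonneg_part.
  - by move=> a; have := res_aug_homog a; rewrite deg0.
  - exact: minimal_aug.
  - exact: res_aug_surj.
have step i : (forall a : 'I_(res_rank F i), res_deg a = i%:Z) ->
    (forall n, linear_to n (diff_image i)) ->
    (forall a : 'I_(res_rank F i.+1), res_deg a = i.+1%:Z).
  move=> degi lini.
  have degP (a : 'I_(res_rank F i.+1)) :
      exists t : nat, res_deg a = i.+1%:Z + t%:Z.
    have nz := @minimal_neq0 _ _ _ a (@minimal_diff_row i).
    case: (@eqP _ (diff_row i a) 0) => // _.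
    (* A row of degree 0 would have entries in both k and R_+, and one of
       negative degree would have entries 0. *)
    case e : (res_deg a - i%:Z) => [[|t]|t].
    - case: nz; apply/rowP => b; have := res_diff_homog a b; rewrite degi e /=.
      move=> /graded_scalar [c ec]; have := res_minimal a b.
      by rewrite !mxE ec => /(irrelevant_scalar hR) ->; rewrite scale0r.
    - by exists t; rewrite -[LHS](subrK i%:Z) e !intS addrAC.
    - case: nz; apply/rowP => b; have := res_diff_homog a b; rewrite degi e /=.
      by rewrite !mxE.
  have [t ht] := choice degP.
  move=> a.
  rewrite ht (minimal_degrees (lini 0%N) _ (@minimal_diff_row i)) ?addr0 //.
    move=> {}a; split; last by exists (delta_mx 0 a); rewrite -rowE.
    move=> b; have := res_diff_homog a b.
    by rewrite degi ht mxE intS addrAC addrK -intS.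
  by move=> x /diff_image_comb.
have all_i i : (forall a : 'I_(res_rank F i), res_deg a = i%:Z) /\
    forall n, linear_to n (diff_image i).
  elim: i => [|i [degi lini]].
    split=> // n; rewrite -syz_aug.
    by have [] := linear_to_basis (linM n.+1) (generators_kbasis gaug).
  have degS := step i degi lini; split=> // n.
  have gi : generators (diff_image i) (diff_row i).
    apply: generators_diff_row => a b; have := res_diff_homog a b.
    by rewrite degi degS intS addrK mxE.
  rewrite -syz_diff_row.
  by have [] := linear_to_basis (lini n.+1) (generators_kbasis gi).
split=> // i; first by case: (all_i i).
apply: generators_diff_row => a b; have := res_diff_homog a b.
by case: (all_i i) => -> _; case: (all_i i.+1) => -> _; rewrite intS addrK mxE.
Qed.

End GivenResolution.
End GivenModule.

(** * Modules with components in degrees 0 and 1 *)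

Section TwoDegrees.
Context (M : lmodType R) (gM : int -> set M) (hM : graded_module gR gM).
Hypothesis hM01 : forall j : int, j <> 0 -> j <> 1 -> gM j = [set 0].

(** The slope d of the linear resolution is the degree of its first generators.
    It is 0 or 1, as these are non-zero elements of M, and it is not 1, since
    elements generated in degree 1 have no component of degree 0. *)
Lemma koszul_generators : koszul_module gR gM ->
  exists b (g : 'I_b -> M), [/\ (0 < b)%N, generators (nonneg_part gM) g
    & forall n, linear_to n (syz g)].
Proof.
move=> [[b [F hF] [d hd]] [[m Mm m0] _]].
have degF i (a : 'I_(res_rank F i)) : res_deg a = i%:Z + d.
  case: (@eqP _ (res_deg a - i%:Z) d) => [<-|/hd]; first by rewrite addrC subrK.
  by rewrite hF => /card0_eq/(_ a); rewrite inE eqxx.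
have rk0 : (0 < res_rank F 0)%N.
  rewrite lt0n; apply/eqP => rk; apply: m0.
  have [v ->] := res_aug_surj F m; rewrite big1 // => a.
  by have := ltn_ord a; rewrite {2}rk.
have augd (a : 'I_(res_rank F 0)) : gM d (res_aug a).
  by have := res_aug_homog a; rewrite degF add0r.
have d0 : d = 0.
  have nz := @minimal_neq0 _ _ _ (Ordinal rk0) (minimal_aug (F := F)).
  case: (@eqP _ d 0) => // dn0; case: (@eqP _ d 1) => [d1|dn1]; last first.
    by case: nz; have := augd (Ordinal rk0); rewrite hM01.
  (* With m in degree 0 and its expansion in degrees above 0, the difference of
     the two is a vanishing sum of components starting with m. *)
  case: m0; have [v ev] := res_aug_surj F m.
  have [l [f [hf /(_ l (leqnn l)) fE]]] := row_decomp v.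
  pose f' j := if j is j'.+1 then - comb (@res_aug _ _ _ _ _ F) (f j') else m.
  apply: (graded_indep_nonneg_part hM (n := l.+1) (f := f') _ _ (j := 0%N)) => //.
    have hN := graded_nonneg_part hM.
    case=> [|j] //=; have [N0 hB _] := hN j.+1; rewrite -sub0r; apply: hB => //.
    rewrite -addn1; apply: (graded_sub_comb hN (hf j)) => a.
    by have := augd a; rewrite d1.
  rewrite big_ord_recl /= sumrN -linear_sum -fE ev; apply/eqP.
  by rewrite subr_eq0.
exists (res_rank F 0), (@res_aug _ _ _ _ _ F); split=> // [|n].
  apply: minimal_generators => [|||| j x _].
  - exact: graded_nonneg_part.
  - exact: graded_indep_nonneg_part.
  - by move=> a; have := augd a; rewrite d0.
  - exact: minimal_aug.
  - exact: res_aug_surj.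
by rewrite syz_aug; apply: linear_to_diff_image degF n 0%N.
Qed.

Lemma koszul_ring : koszul_module gR gM -> koszul_algebra hR.
Proof.
move=> /koszul_generators [b [g [b0 gg hs]]]; apply: koszul_of_linear.
have hN := graded_nonneg_part hM.
have [_ [m [_ [w [_ kw _]]]]] := generators_rank 0 hN gg.
apply: linear_to_irr_rows_of_module b0 hN gg _ kw hs => j x.
by rewrite /nonneg_part hM01.
Qed.

End TwoDegrees.

Lemma krank_set0 (V : lmodType R) : krank [set 0 : V] = 0%N.
Proof.
apply: krankE; exists (fun=> 0); split=> [[]//|v ->|c _ []//].
by exists (fun=> 0); rewrite big_ord0.
Qed.

Lemma generators_krank (V : lmodType R) (N : nat -> set V) b (g : 'I_b -> V) :
  graded_sub N -> generators N g ->
  krank (N 0%N) = b /\ forall j, (krank (syz g j) + krank (N j.+1))%N =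
                         (b * krank (gR j.+1 : set R^o))%N.
Proof.
move=> hN gg; split=> [|j].
  exact: krankE (kbasis_krank (generators_kbasis gg)).
have [n [m [z [w [kz kw <-]]]]] := generators_rank j hN gg.
by rewrite (krankE (kbasis_krank kz)) (krankE (kbasis_krank kw)).
Qed.

(** Induction on j shows w i j = mu j for all i at once: both w i (j+1) and
    mu (j+1) are obtained by removing from P h_(j+1) a number w i' j, which
    does not depend on i'. *)
Lemma hilbert_recursion P (h mu : nat -> nat) (w : nat -> nat -> nat) :
  (forall i, w i 0%N = P) -> mu 0%N = P ->
  (forall j, w 0%N j + mu j.+1 = P * h j.+1)%N ->
  (forall i j, w i.+1 j + w i j.+1 = P * h j.+1)%N ->
  forall j, (mu j + mu j.+1 = P * h j.+1)%N.
Proof.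
move=> w0 mu0 hmu hw.
have wmu j : forall i, w i j = mu j.
  elim: j => [|j IHj] i; first by rewrite w0.
  by apply/eqP; rewrite -(eqn_add2l (mu j)) -{1}(IHj i.+1) hw -(hmu j) IHj.
by move=> j; rewrite -(wmu j 0%N).
Qed.

Lemma hilbert_of_betti (M : lmodType R) (gM : int -> set M) p b :
  graded_module gR gM ->
  (forall j : int, j <> 0 -> j <> 1 -> gM j = [set 0]) ->
  koszul_module gR gM -> graded_betti gR gM b ->
  (forall i : nat, (b i i%:Z)%:Z = p) ->
  let e := krank (gR 1%N : set R^o) in
  [/\ (0 < e)%N, krank (gR 2%N : set R^o) = e.-1,
      forall j, krank (gR j.+3 : set R^o) = 0%N,
      (krank (gM 0))%:Z = p & (krank (gM 1))%:Z = p * e.-1%:Z].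
Proof.
move=> hM hM01 hK [F hF] hp e.
have [c [g [c0 gg hs]]] := koszul_generators hM hM01 hK.
have hN := graded_nonneg_part hM.
have linM n : linear_to n (nonneg_part gM).
  by case: n => [|n]; exists c, g.
have [degF gaug gim] := resolution_linear hM F hM01 linM.
have rkF i : res_rank F i = b i i%:Z.
  rewrite hF -[LHS]card_ord; apply: eq_card => a.
  by rewrite !inE degF eqxx.
have rkP i : res_rank F i = b 0%N 0.
  by apply/eqP; rewrite rkF -eqz_nat hp (hp 0%N).
set P := b 0%N 0 in rkP.
have [mu0 hmu] := generators_krank hN gaug.
have hw i := generators_krank (@graded_diff_image _ _ F i) (gim i).
have P0 : (0 < P)%N.
  rewrite -(rkP 0%N) -mu0.
  by rewrite (krankE (kbasis_krank (generators_kbasis gg))).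
pose h j := krank (gR j : set R^o).
have rec j :
    (krank (nonneg_part gM j) + krank (nonneg_part gM j.+1) = P * h j.+1)%N.
  apply: (@hilbert_recursion P h (fun j => krank (nonneg_part gM j))
    (fun i j => krank (@diff_image _ _ F i j))) => {j}.
  - by move=> i; rewrite (proj1 (hw i)) rkP.
  - by rewrite mu0 rkP.
  - by move=> j; rewrite -syz_aug hmu rkP.
  - by move=> i j; rewrite -syz_diff_row (proj2 (hw i)) rkP.
have M0 j : krank (nonneg_part gM j.+2) = 0%N.
  by rewrite /nonneg_part hM01 // krank_set0.
have r1 : krank (nonneg_part gM 1) = (P * h 2%N)%N by rewrite -rec M0 addn0.
have he : e = (h 2%N).+1.
  by apply/eqP; rewrite -(eqn_pmul2l P0) -(rec 0%N) mu0 rkP r1 mulnS.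
have pP : p = P%:Z by rewrite -(hp 0%N).
rewrite -/e he; split=> // [j||].
- have /esym/eqP := rec j.+2; rewrite !M0 muln_eq0 (gtn_eqF P0).
  by move/eqP.
- by rewrite pP -(rkP 0%N) -mu0.
- by rewrite pP -PoszM -r1.
Qed.

End Graded.

Theorem theorem1 (k : fieldType) (R : comAlgType k) (gR : nat -> set R)
  (hR : standard_graded gR)
  (e : nat) (he : e = krank (gR 1%N : set R^o))
  (M : lmodType R) (gM : int -> set M)
  (hM : graded_module gR gM) (hfg : fin_generated M)
  (hM0 : exists m : M, m <> 0)
  (hM01 : forall j : int, j <> 0 -> j <> 1 -> gM j = [set 0])
  (hK : koszul_module gR gM) :
  koszul_algebra hR /\
  (forall (p : int) (b : nat -> int -> nat),
     graded_betti gR gM b -> (forall i : nat, (b i i%:Z)%:Z = p) ->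
     hilbert_series (zgrading gR : int -> set R^o)
       = series_of_poly ((1 + 'X) * (1 + (e%:Z - 1) *: 'X)) /\
     hilbert_series gM = series_of_poly (p *: (1 + (e%:Z - 1) *: 'X))).
Proof.
split=> [|p b hb hp]; first exact: koszul_ring hM hM01 hK.
have [e0 h2 h3 mu0 mu1] := hilbert_of_betti hR hM hM01 hK hb hp.
have h0 : krank (gR 0%N : set R^o) = 1%N.
  exact: krankE (kbasis_krank (kbasis_scalars hR)).
move: e0 h2 mu1; rewrite -he; case: e he => // c he _ /= h2 mu1.
have -> : c.+1%:Z - 1 = c%:Z by rewrite intS addrAC subrr add0r.
have -> : (1 + 'X) * (1 + c%:Z *: 'X) =
    1 + (1 + c%:Z) *: 'X + c%:Z *: 'X^2 :> {poly int}.
  rewrite mulrDl mul1r mulrDr mulr1 -scalerAr -expr2 scalerDl scale1r.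
  by rewrite -!addrA; congr (_ + _); rewrite addrCA.
split; apply/funext => -[n|n]; rewrite /hilbert_series /=.
- rewrite !coefE; case: n => [|[|[|n]]] /=.
  + by rewrite h0 !mulr0 !addr0.
  + by rewrite -he mulr1 mulr0 addr0 add0r intS.
  + by rewrite h2 mulr1 mulr0 !add0r.
  + by rewrite h3 !mulr0 !addr0.
- by rewrite krank_set0.
- rewrite !coefE; case: n => [|[|n]] /=.
  + by rewrite mu0 mulr0 addr0 mulr1.
  + by rewrite mu1 mulr1 add0r.
  + by rewrite hM01 // krank_set0 mulr0 addr0 mulr0.
- by rewrite hM01 // krank_set0.
Qed.
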